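(* Let $\mathrm{OBJ}\in\{\mathrm{BAI},\mathrm{LS}\}$ and $\delta\in(0,1)$. Consider the heteroskedastic linear model of the context, with the noise variances $(\sigma_x^2)_{x\in\mathcal{X}}$ known. Then any algorithm that is $\delta$-PAC for $\mathrm{OBJ}$ satisfies, for every $\theta^*\in\Theta_{\mathrm{OBJ}}$, $$\mathbb{E}_{\theta^*}[\tau]\ \ge\ 2\log\!\left(\frac{1}{2.4\,\delta}\right)\psi^*_{\mathrm{OBJ}},$$ where $$\psi^*_{\mathrm{OBJ}}=\min_{\lambda\in P_{\mathcal{X}}}\ \max_{h\in\mathcal{H}_{\mathrm{OBJ}},\,q\in\mathcal{Q}_{\mathrm{OBJ}}}\ \frac{\|h-q\|^2_{(\sum_{x\in\mathcal{X}}\lambda_x\sigma_x^{-2}xx^\top)^{-1}}}{\big((h-q)^\top\theta^*-b_{\mathrm{OBJ}}\big)^2}.$$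
   Context: Model. $\mathcal{X}\subset\mathbb{R}^d$ is finite with $\mathrm{span}(\mathcal{X})=\mathbb{R}^d$; $\mathcal{Z}\subset\mathbb{R}^d$ is finite (with at least two elements for BAI). Each pull of $x\in\mathcal{X}$ yields $y=x^\top\theta^*+\eta$ with $\eta\sim\mathcal{N}(0,\sigma_x^2)$ independent across pulls, $\sigma_x^2=x^\top\Sigma^*x>0$ for a fixed positive semidefinite $\Sigma^*$. $\alpha\in\mathbb{R}$ is a given threshold (for LS). Objectives. BAI (best-arm identification): $\mathcal{H}_{\mathrm{BAI}}=\{z^*\}$ with $z^*=\arg\max_{z\in\mathcal{Z}}z^\top\theta^*$, $\mathcal{Q}_{\mathrm{BAI}}=\mathcal{Z}\setminus\{z^*\}$, $b_{\mathrm{BAI}}=0$. LS (level-set identification): $\mathcal{H}_{\mathrm{LS}}=\{z\in\mathcal{Z}:z^\top\theta^*>\alpha\}$, $\mathcal{Q}_{\mathrm{LS}}=\{0\}$, $b_{\mathrm{LS}}=\alpha$. The parameter space $\Theta_{\mathrm{BAI}}$ is the set of $\theta\in\mathbb{R}^d$ for which $\arg\max_{z\in\mathcal{Z}}z^\top\theta$ is unique, and $\Theta_{\mathrm{LS}}$ is the set of $\theta\in\mathbb{R}^d$ with $z^\top\theta\ne\alpha$ for all $z\in\mathcal{Z}$. Algorithms. An algorithm consists of an adaptive sampling rule (the next arm is chosen based on past arms and observations), a stopping time $\tau$ (total number of pulls), and a returned set $\widehat{\mathcal{H}}$. It is $\delta$-PAC for OBJ if for every $\theta\in\Theta_{\mathrm{OBJ}}$,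 $\mathbb{P}_\theta(\widehat{\mathcal{H}}=\mathcal{H}_{\mathrm{OBJ}})\ge1-\delta$, where $\mathcal{H}_{\mathrm{OBJ}}$ is computed with $\theta$ in place of $\theta^*$. Notation. $P_{\mathcal{X}}$ is the set of probability distributions on $\mathcal{X}$; $\|v\|_A^2=v^\top Av$; for singular positive semidefinite $B$, $\|v\|^2_{B^{-1}}$ is read with the pseudoinverse if $v\in\mathrm{range}(B)$ and as $+\infty$ otherwise; a maximum over the empty set is $0$. *)

(* Defs.v *)
From HB Require Import structures.
From mathcomp Require Import all_boot all_order all_algebra.
From mathcomp Require Import finmap.
From mathcomp Require Import all_classical all_reals all_analysis.

Set Implicit Arguments.
Unset Strict Implicit.
Unset Printing Implicit Defensive.

Import Order.TTheory GRing.Theory Num.Theory.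

Local Open Scope classical_set_scope.
Local Open Scope ring_scope.

Section Linear_algebra.
Variables (R : realType) (d : nat).
Implicit Types (u v : 'cV[R]_d) (A B G : 'M[R]_d).

Definition dot u v : R := (u^T *m v) 0 0.

Definition quad A v : R := dot v (A *m v).

Definition psd A : Prop := A^T = A /\ forall v, 0 <= quad A v.

(* The four Penrose conditions. *)
Definition penrose B G : Prop :=
  [/\ B *m G *m B = B, G *m B *m G = G,
      (B *m G)^T = B *m G & (G *m B)^T = G *m B].

(* The Moore-Penrose inverse. MathComp's [pinvmx] is only a generalized
   inverse (first Penrose condition), hence this definition; [pinvP] and
   [penrose_uniq] show that it does not depend on the choice. *)
Definition pinv B : 'M[R]_d := xget 0 [set G | penrose B G].

Lemma gram_unitmx m n (F : 'M[R]_(m, n)) : row_free F -> F *m F^T \in unitmx.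
Proof.
move=> Ffree; rewrite -row_free_unit -kermx_eq0; apply/eqP/row_matrixP => i.
rewrite row0; set u := row i _.
have : u *m F *m (u *m F)^T = 0.
  by rewrite trmx_mul !mulmxA -(mulmxA u F) -row_mul mulmx_ker row0 mul0mx.
move/matrixP/(_ 0 0); rewrite !mxE => /eqP; rewrite psumr_eq0; last first.
  by move=> k _; rewrite [X in _ * X]mxE -expr2 sqr_ge0.
move=> /allP uF0; apply: (row_free_inj Ffree); rewrite mul0mx.
apply/rowP => k; have := uF0 k (mem_index_enum k).
by rewrite [X in _ * X]mxE mulf_eq0 orbb => /eqP ->; rewrite mxE.
Qed.

Lemma penrose_uniq B G1 G2 : penrose B G1 -> penrose B G2 -> G1 = G2.
Proof.
move=> [B1 G11 S1 T1] [B2 G22 S2 T2].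
have E : B *m G1 = B *m G2.
  by rewrite -{1}S1 -{1}B2 -(mulmxA (B *m G2)) trmx_mul S1 S2 mulmxA B1.
have E' : G1 *m B = G2 *m B.
  by rewrite -{1}T1 -{1}B2 -mulmxA mulmxA trmx_mul T1 T2 -mulmxA (mulmxA B) B1.
by rewrite -G11 -mulmxA E mulmxA E' G22.
Qed.

Lemma penrose_factor r (C : 'M[R]_(d, r)) (F : 'M[R]_(r, d)) :
  row_full C -> row_free F -> exists G, penrose (C *m F) G.
Proof.
move=> Cfull Ffree.
have uF : F *m F^T \in unitmx by exact: gram_unitmx.
have uC : C^T *m C \in unitmx.
  rewrite -{2}[C]trmxK; apply: gram_unitmx.
  by rewrite /row_free mxrank_tr.
set B := C *m F; set f := invmx (F *m F^T); set c := invmx (C^T *m C).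
have fT : f^T = f by rewrite /f trmx_inv trmx_mul trmxK.
have cT : c^T = c by rewrite /c trmx_inv trmx_mul trmxK.
pose G := F^T *m f *m c *m C^T.
have BG : B *m G = C *m c *m C^T.
  by rewrite /B /G !mulmxA -(mulmxA C F) -(mulmxA C _ f) mulmxV // mulmx1.
have GB : G *m B = F^T *m f *m F.
  by rewrite /B /G !mulmxA -(mulmxA _ C^T) -(mulmxA _ c) mulVmx // mulmx1.
exists G; split.
- by rewrite BG {1}/B !mulmxA -(mulmxA _ C^T) -(mulmxA C c) mulVmx // mulmx1.
- rewrite GB {1}/G !mulmxA -(mulmxA _ F) -(mulmxA _ (F *m F^T)).
  by rewrite mulmxV // mulmx1.
- by rewrite BG !trmx_mul trmxK cT mulmxA.
- by rewrite GB !trmx_mul trmxK fT mulmxA.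
Qed.

Lemma pinvP B : penrose B (pinv B).
Proof.
have [G] : exists G, penrose B G.
  rewrite -(mulmx_base B); apply: penrose_factor.
    exact: col_base_full.
  exact: row_base_free.
by rewrite /pinv; case: xgetP => [? _ ? //|/(_ G)].
Qed.

Definition range_mx B : set 'cV[R]_d := [set v | exists u, v = B *m u].

(* ||v||^2_{B^{-1}} for positive semidefinite B, possibly singular. *)
Definition inv_norm2 B v : \bar R :=
  if v \in range_mx B then (quad (pinv B) v)%:E else +oo%E.

End Linear_algebra.

Inductive objective := BAI | LS.

Section Objectives.
Variables (R : realType) (d : nat).
Implicit Types (Z : {fset 'cV[R]_d}) (theta : 'cV[R]_d) (alpha : R).

Definition argmax_set Z theta : {fset 'cV[R]_d} :=
  [fset z in Z | [forall z' : Z, dot (val z') theta <= dot z theta]]%fset.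

Definition Theta (obj : objective) Z alpha : set 'cV[R]_d :=
  match obj with
  | BAI => [set theta | exists z, argmax_set Z theta = [fset z]%fset]
  | LS => [set theta | forall z, z \in Z -> dot z theta <> alpha]
  end.

(* For BAI this is {z^*} as soon as theta is in [Theta BAI]. *)
Definition Hset (obj : objective) Z alpha theta : {fset 'cV[R]_d} :=
  match obj with
  | BAI => argmax_set Z theta
  | LS => [fset z in Z | alpha < dot z theta]%fset
  end.

Definition Qset (obj : objective) Z theta : {fset 'cV[R]_d} :=
  match obj with
  | BAI => (Z `\` argmax_set Z theta)%fset
  | LS => [fset 0]%fset
  end.

Definition offset (obj : objective) alpha : R :=
  match obj with BAI => 0 | LS => alpha end.

End Objectives.

Section Complexity.
Variables (R : realType) (d : nat) (X : {fset 'cV[R]_d}).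
Variables (Sigma : 'M[R]_d).

Definition distributions : set {ffun X -> R} :=
  [set lam | (forall x, 0 <= lam x) /\ \sum_(x : X) lam x = 1].

Definition design_mx (lam : {ffun X -> R}) : 'M[R]_d :=
  \sum_(x : X) (lam x * (quad Sigma (val x))^-1) *: (val x *m (val x)^T).

(* All the terms of the maximum are nonnegative, so that 0 is a neutral start,
   and the value when there is no pair (h, q). *)
Definition design_value (obj : objective) (Z : {fset 'cV[R]_d}) (alpha : R)
    (theta : 'cV[R]_d) (lam : {ffun X -> R}) : \bar R :=
  \big[maxe/0%E]_(h <- Hset obj Z alpha theta)
    \big[maxe/0%E]_(q <- Qset obj Z theta)
      (inv_norm2 (design_mx lam) (h - q)
        / ((dot (h - q) theta - offset obj alpha) ^+ 2)%:E)%E.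

(* A minimum: [design_value] is lower semicontinuous in lam, and the set of
   distributions on X is compact, so that the infimum is attained. *)
Definition psi_star (obj : objective) (Z : {fset 'cV[R]_d}) (alpha : R)
    (theta : 'cV[R]_d) : \bar R :=
  ereal_inf [set design_value obj Z alpha theta lam | lam in distributions].

End Complexity.

Section Algorithms.
Variables (R : realType) (d : nat) (X : {fset 'cV[R]_d}).
Context {disp : measure_display} {Omega : measurableType disp}.

(* The information available after t pulls: the internal randomness G of the
   algorithm together with the arms A s and the observations Y s, for s < t. *)
Definition history (G : set (set Omega)) (A : nat -> Omega -> X)
    (Y : nat -> Omega -> R) (t : nat) : set (set Omega) :=
  <<s G `|` \bigcup_(s in [set s | (s < t)%N])
        ([set A s @^-1` [set x] | x in [set: X]] `|`
         [set Y s @^-1` B | B in measurable]) >>.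

(* Pulls are numbered from 0. [tau] is [None] when the algorithm never stops.
   Taking [seed] to be the trivial sigma-algebra gives nonrandomized rules. *)
Record algorithm (Y : nat -> {mfun Omega >-> R}) := Algorithm {
  seed : set (set Omega) ;
  arm : nat -> Omega -> X ;
  tau : Omega -> option nat ;
  Hhat : Omega -> {fset 'cV[R]_d} ;
  seed_sigma_algebra : sigma_algebra setT seed ;
  seed_measurable : seed `<=` measurable ;
  arm_adapted : forall t x, history seed arm Y t (arm t @^-1` [set x]) ;
  tau_stopping : forall t, history seed arm Y t (tau @^-1` [set Some t]) ;
  Hhat_measurable : forall H, measurable (Hhat @^-1` [set H]) ;
  Hhat_adapted : forall t H,
    history seed arm Y t (tau @^-1` [set Some t] `&` Hhat @^-1` [set H])
}.

Variables (Y : nat -> {mfun Omega >-> R}) (alg : algorithm Y).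

(* The family P describes the linear model: the internal randomness has the
   same law for every theta, and given the past and the fact that x is pulled,
   the noise Y t - x^T theta has law N(0, x^T Sigma x). The second parameter of
   [normal_prob] is a standard deviation. *)
Definition heteroskedastic_model (Sigma : 'M[R]_d)
    (P : 'cV[R]_d -> probability Omega R) : Prop :=
  (forall theta theta' E, seed alg E -> P theta E = P theta' E) /\
  (forall theta t (x : X) E (B : set R),
     history (seed alg) (arm alg) Y t E -> measurable B ->
     let pull := E `&` arm alg t @^-1` [set x] in
     P theta (pull `&` [set w | B (Y t w - dot (val x) theta)]) =
     (P theta pull *
      normal_prob 0 (Num.sqrt (quad Sigma (val x))) B)%E).

Definition pac (obj : objective) (Z : {fset 'cV[R]_d}) (alpha delta : R)
    (P : 'cV[R]_d -> probability Omega R) : Prop :=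
  forall theta, Theta obj Z alpha theta ->
    ((1 - delta)%:E <= P theta (Hhat alg @^-1` [set Hset obj Z alpha theta]))%E.

Definition pulls (w : Omega) : \bar R :=
  if tau alg w is Some n then n%:R%:E else +oo%E.

End Algorithms.

(* Main.v *)
From HB Require Import structures.
From mathcomp Require Import all_boot all_order all_algebra.
From mathcomp Require Import finmap.
From mathcomp Require Import all_classical all_reals all_analysis.
From mathcomp Require Import measurable_realfun.
From mathcomp Require Import ring lra.
Require Import Defs.

(* Change of measure along the adaptive sampling: on the events observable after
   t pulls, P_theta' has density exp (sum of the Gaussian log-likelihood ratios
   of the pulls) with respect to P_theta, and stopping at tau replaces the sum by
   a sum up to tau, whose mean is minus the sum over x of E[N_x] times the
   Gaussian divergence of arm x. The variational formula for the divergence,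
   tested on the event that the answer is H(theta), gives
     sum_x E[N_x] (x^T (theta - theta'))^2 / (2 sigma_x^2) >= ln (1 / (2.4 delta))
   for every alternative theta'. With lambda = E[N] / E[tau], moving theta along
   the pseudoinverse of the design matrix applied to h - q until h stops beating
   q turns this into the bound on each term of the maximum. *)

Set Implicit Arguments.
Unset Strict Implicit.
Unset Printing Implicit Defensive.

Import Order.TTheory GRing.Theory Num.Theory.
Import numFieldNormedType.Exports HBNNSimple.

Local Open Scope classical_set_scope.
Local Open Scope ring_scope.

(** * Densities, Gaussian shifts and independence *)

(** [tau] may be unbounded and a run may never stop, so the likelihood ratio at [tau] is not handled
    directly. All integrals are taken at min(tau, n), where the log-likelihood is a finite sum of
    integrable terms; [n] goes to infinity only in a numerical inequality, with an error of order
    E[tau] / (n + 1) given by Markov's inequality. The case of infinite E[tau] is trivial. The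
    variational formula is used through its elementary half, a consequence of 1 + x <= exp x. Tested
    on a multiple of an indicator it is monotone in both probabilities of the event, so the
    guarantees 1 - delta and delta can be inserted as inequalities. The constant 2.4 bounds the
    binary divergence between delta and 1 - delta from below by ln (1 / (2.4 delta)) for delta <
    5/12; for larger delta the logarithm is at most 0 and the bound is trivial. The parameter that
    just stops [h] from beating [q] may lie on a tie or on the threshold, outside [Theta]. Hence the
    displacements are taken with strict inequalities, perturbed into [Theta], and the optimal one is
    reached only as a limit. *)

Lemma ge0_integral_density d (T : measurableType d) (R : realType)
    (mu nu : {measure set T -> \bar R}) (g : T -> R) (f : T -> \bar R) :
    measurable_fun setT g -> (forall x, 0 <= g x) ->
    (forall A, measurable A -> nu A = \int[mu]_(x in A) (g x)%:E)%E ->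
    measurable_fun setT f -> (forall x, 0 <= f x)%E ->
  (\int[nu]_x f x = \int[mu]_x (f x * (g x)%:E))%E.
Proof.
move=> mg g0 nuE mf f0; pose h := nnsfun_approx measurableT mf.
have hf x : (EFin \o h n) x @[n --> \oo] --> f x.
  by apply: cvg_nnsfun_approx.
have hfg x : ((h n x)%:E * (g x)%:E)%E @[n --> \oo] --> (f x * (g x)%:E)%E.
  by apply: cvgeZr => //; exact: hf.
transitivity (lim (\int[nu]_x (EFin \o h n) x @[n --> \oo]))%E.
  rewrite -monotone_convergence//.
  - by apply: eq_integral => x _; apply/esym/cvg_lim.
  - by move=> n; exact/measurable_EFinP.
  - by move=> n x _; rewrite lee_fin.
  - by move=> x _ a b ab; rewrite lee_fin; exact/lefP/nd_nnsfun_approx.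
transitivity (lim (\int[mu]_x ((h n x)%:E * (g x)%:E) @[n --> \oo]))%E; last first.
  rewrite -monotone_convergence//.
  - by apply: eq_integral => x _; apply/cvg_lim => //; exact: hfg.
  - by move=> n; apply: emeasurable_funM; exact/measurable_EFinP.
  - by move=> n x _; rewrite mule_ge0 ?lee_fin.
  - move=> x _ a b ab; rewrite lee_wpmul2r ?lee_fin//.
    exact/lefP/nd_nnsfun_approx.
congr (lim (_ @ \oo)); apply/funext => n.
transitivity (\sum_(r \in range (h n)) (r%:E * nu (h n @^-1` [set r])))%E.
  by rewrite integralT_nnsfun sintegralE.
transitivity (\int[mu]_x (\sum_(r \in range (h n))
    ((r * \1_(h n @^-1` [set r]) x)%:E * (g x)%:E)))%E; last first.
  apply: eq_integral => x _.
  rewrite -ge0_mule_fsuml => [|y]; last exact: nnfun_muleindic_ge0.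
  by rewrite fsumEFin// -(fimfunE _ x).
rewrite ge0_integral_fsum//; last 2 first.
- move=> r; apply: emeasurable_funM; last exact/measurable_EFinP.
  exact/measurable_EFinP/measurable_funM.
- by move=> r x _; rewrite mule_ge0 ?lee_fin// -lee_fin nnfun_muleindic_ge0.
apply: eq_fsbigr => r rh.
have r0 : 0 <= r by move: rh; rewrite inE => -[t _ <-].
under eq_integral do rewrite EFinM -muleA.
rewrite ge0_integralZl//; last 2 first.
- by apply: emeasurable_funM; exact/measurable_EFinP.
- by move=> x _; rewrite mule_ge0 ?lee_fin.
rewrite nuE// integral_mkcond; congr (_ * _)%E; apply: eq_integral => x _.
rewrite patchE indicE; case: ifPn => _; by rewrite ?mul1e ?mul0e.
Qed.

Lemma lebesgue_measure_shift (R : realType) (c : R) (A : set R) :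
  measurable A -> pushforward lebesgue_measure
    (fun x : measurableTypeR R => x + c : measurableTypeR R) A = lebesgue_measure A.
Proof.
move=> mA; apply/esym.
have mf : measurable_fun setT (fun x : measurableTypeR R => x + c : measurableTypeR R).
  exact: measurable_funD.
apply: lebesgue_measure_unique => //= _ [[a b]] _ <-.
rewrite /pushforward.
have -> : (fun x : R => x + c) @^-1` `]a, b] = `]a - c, b - c]%classic.
  by apply/seteqP; split => x /=; rewrite !in_itv/= ltrBlDr lerBrDr.
rewrite !lebesgue_measure_itv/= !lte_fin ltrD2r -!EFinB.
by congr (if _ then _%:E else _); ring.
Qed.

Lemma normal_prob_shift (R : realType) (c s : R) (B : set R) : s != 0 ->
  measurable B -> normal_prob 0 s [set x | B (x + c)] = normal_prob c s B.
Proof.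
move=> s0 mB; rewrite /normal_prob.
pose phi (x : measurableTypeR R) : measurableTypeR R := x + c.
have mphi : measurable_fun setT phi.
  exact: measurable_funD.
transitivity (\int[pushforward lebesgue_measure phi]_(x in B)
    (normal_pdf c s x)%:E)%E; last first.
  by apply: eq_measure_integral => A mA _; exact: lebesgue_measure_shift.
rewrite (@ge0_integral_pushforward _ _ _ _ _ phi mphi lebesgue_measure B
  (fun x => (normal_pdf c s x)%:E)); last 3 first.
- exact: mB.
- apply/measurable_funTS/measurable_EFinP; exact: measurable_normal_pdf.
- by move=> x _; rewrite lee_fin normal_pdf_ge0.
apply: eq_integral => x _; congr EFin => /=.
by rewrite !normal_pdfE//= (normal_fun_center c)/= addrK.
Qed.

Lemma ge0_integral_normal_prob (R : realType) (s : R) (f : R -> \bar R) :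
  measurable_fun setT f -> (forall x, 0 <= f x)%E ->
  (\int[normal_prob 0 s]_x f x =
   \int[lebesgue_measure]_x (f x * (normal_pdf 0 s x)%:E))%E.
Proof.
move=> mf f0; apply: ge0_integral_density => //.
  exact: measurable_normal_pdf.
by move=> x; exact: normal_pdf_ge0.
Qed.

(** Completing the square: the exponential factor is the density of N(c, s^2) relative to N(0, s^2).
    It serves both as the likelihood ratio of a single pull and, with [B] the whole line, as a
    formula for exponential moments. *)
Lemma normal_prob_tilt (R : realType) (c s : R) (B : set R) : s != 0 ->
  measurable B ->
  (\int[normal_prob 0 s]_x (\1_B x * expR ((c * x - c ^+ 2 / 2) / s ^+ 2))%:E =
   normal_prob c s B)%E.
Proof.
move=> s0 mB; rewrite ge0_integral_normal_prob.
- rewrite /normal_prob [RHS]integral_mkcond; apply: eq_integral => x _.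
  rewrite patchE indicE; case: ifPn => _; rewrite ?mul0r ?mul0e// mul1r -EFinM.
  rewrite !normal_pdfE//= mulrCA /normal_fun -expRD; congr (_ * expR _)%:E.
  by field.
- apply/measurable_EFinP/measurable_funM => //.
  apply: measurableT_comp => //; apply: measurable_funM => //.
  by apply: measurable_funB => //; exact: measurable_funM.
- by move=> x; rewrite lee_fin mulr_ge0 ?expR_ge0.
Qed.

Lemma normal_prob_opp (R : realType) (s : R) (B : set R) :
  s != 0 -> measurable B -> pushforward (normal_prob 0 s) (-%R : R -> measurableTypeR R) B = normal_prob 0 s B.
Proof.
move=> s0 mB; rewrite /pushforward /normal_prob.
have mopp : measurable_fun setT (-%R : measurableTypeR R -> measurableTypeR R).
  exact: oppr_measurable.
transitivity (\int[pushforward lebesgue_measure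
    (-%R : _ -> measurableTypeR R)]_(x in B) (normal_pdf 0 s x)%:E)%E; last first.
  by apply: eq_measure_integral => A mA _; exact: lebesgue_measureN.
rewrite (@ge0_integral_pushforward _ _ _ _ _ _ mopp lebesgue_measure B
  (fun x => (normal_pdf 0 s x)%:E)); last 3 first.
- exact: mB.
- apply/measurable_funTS/measurable_EFinP; exact: measurable_normal_pdf.
- by move=> x _; rewrite lee_fin normal_pdf_ge0.
apply: eq_integral => x _; congr EFin => /=.
by rewrite !normal_pdfE//= /normal_fun !subr0 sqrrN.
Qed.

(** Symmetry of the law gives the equality. Integrability and zero mean are expressed through the
    two parts because the product formula under independence is available for nonnegative
    functions. *)
Lemma normal_prob_funeposneg (R : realType) (s : R) : s != 0 ->
  (\int[normal_prob 0 s]_x ((@EFin R)^\- x) = \int[normal_prob 0 s]_x ((@EFin R)^\+ x))%E /\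
  (\int[normal_prob 0 s]_x ((@EFin R)^\+ x) < +oo)%E.
Proof.
move=> s0.
have mE : measurable_fun setT (@EFin R)^\+%E.
  by apply: measurable_funepos; apply/(@measurable_EFinP _ _ _ _ id).
split.
  transitivity (\int[pushforward (normal_prob 0 s) (-%R : R -> measurableTypeR R)]_x ((@EFin R)^\+ x))%E.
    rewrite ge0_integral_pushforward//=.
    rewrite preimage_setT; apply: eq_integral => x _.
    by rewrite funenegE funeposE EFinN.
  by apply: eq_measure_integral => A mA _; exact: normal_prob_opp.
(* The positive part of [x] is at most exp x, and exp x is exp (s^2 / 2) times the tilt with
   [c = s ^+ 2], whose integral is 1. *)
have : (\int[normal_prob 0 s]_x ((expR (s ^+ 2 / 2))%:E * (\1_setT x * expR ((s^+2 * x - (s^+2) ^+ 2 / 2) / s ^+ 2))%:E) < +oo)%E.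
  rewrite ge0_integralZl//.
  - by rewrite normal_prob_tilt// probability_setT mule1 ltry.
  - apply/measurable_EFinP/measurable_funM => //.
    apply: measurableT_comp => //; apply: measurable_funM => //.
    by apply: measurable_funB => //; exact: measurable_funM.
apply: le_lt_trans.  apply: ge0_le_integral => //.
- apply: emeasurable_funM => //; apply/measurable_EFinP/measurable_funM => //.
  apply: measurableT_comp => //; apply: measurable_funM => //.
  by apply: measurable_funB => //; exact: measurable_funM.
- move=> x _; rewrite indicT mul1r -EFinM -expRD funeposE -EFin_max lee_fin.
  rewrite (_ : _ + _ = x); last by field.
  rewrite ge_max expR_ge0 andbT.
  by apply: le_trans (expR_ge1Dx x); rewrite lerDr.
Qed.

Lemma ge0_integral_mrestr d (T : measurableType d) (R : realType)
    (mu : {measure set T -> \bar R}) (D : set T) (mD : measurable D)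
    (f : T -> \bar R) : measurable_fun setT f -> (forall x, 0 <= f x)%E ->
  (\int[mrestr mu mD]_x f x = \int[mu]_(x in D) f x)%E.
Proof.
move=> mf f0; rewrite (@ge0_integral_density _ _ _ mu _ (\1_D))//; last first.
  by move=> A mA; rewrite integral_indic// setIC.
rewrite [RHS]integral_mkcond; apply: eq_integral => x _.
by rewrite patchE indicE; case: ifPn; rewrite ?mule1 ?mule0.
Qed.

(** On [D], the map sending [w] to (w, xi w), with the first coordinate seen only through
    [<<s G >>], has a product law; Tonelli's theorem then separates the factors. Taking [u] on
    [g_sigma_algebraType G] is how its measurability with respect to the past is expressed. *)
Lemma ge0_integral_indep d (T : measurableType d) (R : realType)
    (P : {finite_measure set T -> \bar R}) (G : set (set T)) (D : set T)
    (xi : T -> R) (N : probability (measurableTypeR R) R)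
    (u : g_sigma_algebraType G -> \bar R) (h : R -> \bar R) :
    <<s G >> `<=` measurable -> <<s G >> D -> measurable_fun setT xi ->
    (forall E B, <<s G >> E -> measurable B ->
      P (E `&` D `&` xi @^-1` B) = P (E `&` D) * N B)%E ->
    measurable_fun setT u -> (forall w, 0 <= u w)%E ->
    measurable_fun setT h -> (forall y, 0 <= h y)%E ->
  (\int[P]_(w in D) (u w * h (xi w)) = (\int[P]_(w in D) u w) * \int[N]_y h y)%E.
Proof.
move=> sG sD mxi indep mu u0 mh h0.
have mD : measurable D by exact: sG.
pose TG : measurableType _ := g_sigma_algebraType G.
have mid : measurable_fun setT (id : T -> TG).
  by move=> _ A mA; rewrite setTI; exact: sG.
pose PD : {finite_measure set T -> \bar R} := mrestr P mD.
(* The restriction of [PD] to the smaller sigma-algebra, as the image under the identity, packaged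
   as a finite measure for the product construction. *)
have [mu1 mu1E] : exists mu1 : {finite_measure set TG -> \bar R},
    mu1 = pushforward PD (id : T -> TG) :> (set TG -> \bar R).
  pose m : {measure set TG -> \bar R} :=
    measure_function_pushforward__canonical__measure_function_Measure PD mid.
  have moo : (m setT < +oo)%E by have := fin_num_measure PD _ measurableT; rewrite ge0_fin_numE.
  exists (mfrestr (@measurableT _ TG) moo).
  by by apply/funext => A; transitivity (m (A `&` setT)) => //; rewrite setIT.
pose phi (w : T) : TG * measurableTypeR R := (w, xi w).
have mphi : measurable_fun setT phi by exact: measurable_fun_pair.
pose f (z : TG * measurableTypeR R) := (u z.1 * h z.2)%E.
have mf : measurable_fun setT f.
  apply: emeasurable_funM.
    by apply: measurableT_comp => //; exact: measurable_fst.
  by apply: measurableT_comp => //; exact: measurable_snd.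
have f0 z : (0 <= f z)%E by rewrite /f mule_ge0.
rewrite -(ge0_integral_mrestr P mD (f := f \o phi)); last 2 first.
- exact: measurableT_comp.
- by move=> x; exact: f0.
rewrite -[LHS](@ge0_integral_pushforward _ _ _ _ _ _ mphi PD setT f)//.
have mE A : measurable A -> (mu1 \x N)%E A = pushforward PD phi A.
  move=> mA.
  apply: (@product_measure_unique _ _ _ _ _ mu1 N
    (measure_function_pushforward__canonical__measure_function_Measure PD mphi)) => //.
  move=> A1 B mA1 mB; transitivity (pushforward PD (id : T -> TG) A1 * N B)%E;
    last by rewrite -mu1E.
  rewrite /= /pushforward/= /PD/= /mrestr/=.
  rewrite -indep//; congr (P _); apply/seteqP.
  by split => x /=; rewrite /phi/=; tauto.
rewrite (@eq_measure_integral _ _ _ _ (mu1 \x N)%E); last first.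
  by move=> A mA _; apply/esym; exact: mE.
rewrite (fubini_tonelli1 f)//.
transitivity (\int[mu1]_x (u x * \int[N]_y h y))%E.
  by apply: eq_integral => x _; rewrite /fubini_F /f/=; apply: ge0_integralZl => //; exact: u0.
transitivity ((\int[mu1]_x u x) * \int[N]_y h y)%E.
  by apply: ge0_integralZr => //; exact: integral_ge0.
congr (_ * _)%E; rewrite (_ : integral mu1 _ _ =
  \int[pushforward PD (id : T -> TG)]_x u x)%E; last by rewrite -mu1E.
rewrite ge0_integral_pushforward//=.
rewrite ge0_integral_mrestr//; exact: (measurableT_comp mu mid).
Qed.

(** * The binary divergence *)

(** Turns bounds on logarithms of rationals into rational arithmetic; the exponents 40 and 64 used
    below are large enough for the two bounds required. *)
Lemma expR_ge_expn (R : realType) (x : R) (n : nat) : (0 < n)%N ->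
  0 <= 1 + x / n%:R -> (1 + x / n%:R) ^+ n <= expR x.
Proof.
move=> n0 x0; rewrite (_ : expR x = expR (x / n%:R) ^+ n).
  by rewrite ler_pXn2r// ?nnegrE ?expR_ge0// expR_ge1Dx.
by rewrite -expRM_natl mulrC divfK// pnatr_eq0 -lt0n.
Qed.

Lemma ln2_le (R : realType) : ln 2 <= 7 / 10 :> R.
Proof.
rewrite -[leRHS]expRK ler_ln ?posrE ?expR_gt0//.
have h1 : 2 <= (1 + 7 / 10 / 40) ^+ 40 :> R by lra.
have h2 : 0 <= 1 + 7 / 10 / 40 :> R by lra.
exact: le_trans h1 (@expR_ge_expn R _ 40 isT h2).
Qed.

Lemma ln_8_5_ge (R : realType) : 468 / 1000 <= ln (8 / 5) :> R.
Proof.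
have -> : 8 / 5 = (5 / 8)^-1 :> R by field.
rewrite lnV ?posrE; last by lra.
rewrite lerNr -[leRHS]expRK ler_ln ?posrE ?expR_gt0//.
have h1 : 5 / 8 <= (1 + - (468 / 1000) / 64) ^+ 64 :> R by lra.
have h2 : 0 <= 1 + - (468 / 1000) / 64 :> R by lra.
exact: le_trans h1 (@expR_ge_expn R _ 64 isT h2).
Qed.

(* Replace [ln x] and [ln (1 - x)] by tangent lines at 1/3 and 2/3; the slack in
   the constant 2.4 absorbs the error. *)
Lemma binary_kl_ge (R : realType) (x : R) : 0 < x -> x < 5 / 12 ->
  ln (1 / (24 / 10 * x)) <= (1 - 2 * x) * (ln (1 - x) - ln x).
Proof.
move=> x0 x1.
have ln_le (y z : R) : 0 < y -> 0 < z -> ln y <= ln z + (y / z - 1).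
  move=> y0 z0; rewrite -lerBlDl -ln_div ?posrE//.
  have := @le_ln1Dx R (y / z - 1); rewrite subrKC; apply.
  by rewrite ltrBrDl subrr divr_gt0.
have l5 : ln (8 / 5) = 3 * ln 2 - ln 5 :> R.
  rewrite ln_div ?posrE//; congr (_ - _).
  have -> : 8 = 2 ^+ 3 :> R by ring.
  by rewrite lnXn// mulr_natl.
have l24 : ln (1 / (24 / 10 * x)) = ln 5 - 2 * ln 2 - ln 3 - ln x.
  rewrite div1r lnV ?posrE; last by lra.
  rewrite (_ : 24 / 10 * x = 2 ^+ 2 * 3 / 5 * x); last by field.
  rewrite lnM ?posrE; [|lra..].
  rewrite ln_div ?posrE; [|lra..].
  rewrite lnM ?posrE; [|lra..].
  by rewrite lnXn// mulr2n; ring.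
have x'0 : 0 < 1 - x by lra.
have := ln_le x^-1 3; rewrite invr_gt0 x0 ltr0n => /(_ isT isT).
have := ln_le (1 - x)^-1 (3 / 2); rewrite invr_gt0 x'0 divr_gt0// => /(_ isT isT).
rewrite !lnV ?posrE// ln_div ?posrE//.
have := ln2_le R; have := ln_8_5_ge R; rewrite l5 l24.
set a := ln 2; set b := ln 3; set c := ln 5; set u := ln x; set v := ln (1 - x).
move=> hac ha hv hu.
have hu' : x * - u <= x * b + (1 / 3 - x).
  have := ler_wpM2l (ltW x0) hu; rewrite (_ : x * (b + _) = x * b + (1 / 3 - x))//.
  by field; rewrite gt_eqF.
have hs : 0 < (1 - x)^-1 by rewrite invr_gt0.
set s := (1 - x)^-1 in hv hs *.
have sE : x * s = s - 1 by rewrite /s; field; rewrite gt_eqF.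
have hv' : (1 - 2 * x) * - v <= (1 - 2 * x) * (b - a + (s / (3 / 2) - 1)).
  by apply: ler_wpM2l => //; clear - x1; lra.
have hx : x * a <= x * (7 / 10) by apply: ler_wpM2l => //; exact: ltW.
(* After the tangent bounds ln 3 cancels, and 1 - ln (8/5) + 2 x ln 2 <= (2/3) / (1 - x) remains to
   be shown; the bounds 468/1000 and 7/10 produce the constants here. Times 1 - x, the left side is
   a parabola with vertex at 31/100 and maximum 0.66654, just under 2/3. *)
have key : (532 / 1000 + 14 / 10 * x) <= 2 / 3 * s.
  rewrite /s ler_pdivlMr//.
  have := sqr_ge0 (x - 31 / 100); rewrite expr2 => hq.
  nra.
have e : (1 - 2 * x) * (s / (3 / 2) - 1) = 4 / 3 - 2 / 3 * s - 1 + 2 * x.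
  have -> : (1 - 2 * x) * (s / (3 / 2) - 1) = 2 / 3 * (s - 2 * (x * s)) - (1 - 2 * x).
    by field.
  by rewrite sE; field.
have hv2 : (1 - 2 * x) * - v <= (1 - 2 * x) * (b - a) + (4 / 3 - 2 / 3 * s - 1 + 2 * x).
  by rewrite -e -mulrDr.
lra.
Qed.

(** * Change of measure under adaptive sampling *)

Lemma density_measure d (T : measurableType d) (R : realType)
    (mu : {measure set T -> \bar R}) (g : T -> \bar R) :
    measurable_fun setT g -> (forall x, 0 <= g x)%E ->
  exists nu : {measure set T -> \bar R},
    forall A, nu A = (\int[mu]_(x in A) g x)%E.
Proof.
move=> mg g0; pose nu A := (\int[mu]_(x in A) g x)%E.
have nu0 : nu set0 = 0%E by exact: integral_set0.
have nu_ge0 A : (0 <= nu A)%E by exact: integral_ge0.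
have nu_sigma : semi_sigma_additive nu.
  move=> F mF tF mUF; rewrite /nu ge0_integral_bigcup//.
    by apply: is_cvg_ereal_nneg_natsum_cond => n _ _; exact: nu_ge0.
  exact: measurable_funTS.
pose m : {measure set T -> \bar R} :=
  HB.pack nu (isMeasure.Build _ T R nu nu0 nu_ge0 nu_sigma).
by exists m.
Qed.

Lemma measure_fin_partition d (T : measurableType d) (R : realType)
    (mu : {measure set T -> \bar R}) (I : finType) (f : T -> I) (S : set T) :
    (forall i, measurable (f @^-1` [set i])) -> measurable S ->
  mu S = (\sum_i mu (S `&` f @^-1` [set i]))%E.
Proof.
move=> mf mS.
have mSf i : measurable (S `&` f @^-1` [set i]) by exact: measurableI.
transitivity (\int[mu]_w (\1_S w)%:E)%E; first by rewrite integral_indic// setIT.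
transitivity (\sum_i \int[mu]_w (\1_(S `&` f @^-1` [set i]) w)%:E)%E; last first.
  by apply: eq_bigr => i _; rewrite integral_indic// setIT.
rewrite -ge0_integral_sum//;
  last by move=> i; exact/measurable_EFinP/measurable_indic.
apply: eq_integral => w _; rewrite sumEFin; congr EFin.
rewrite (bigD1 (f w))//= big1 ?addr0; last first.
  move=> i ifw; rewrite indicE memNset//= => -[_ /eqP].
  by rewrite eq_sym (negbTE ifw).
by rewrite !indicE in_setI [X in _ && X]mem_set ?andbT.
Qed.

Section adapted_sampling.
Variables (d : measure_display) (T : measurableType d) (R : realType).
Variables (I : finType) (G : set (set T)) (A : nat -> T -> I) (Y : nat -> T -> R).

(** The generators of [history], kept apart from the sigma-algebra they generate so that [TF t] is a
    measurable type for functions of the past. *)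
Definition past (t : nat) : set (set T) :=
  G `|` \bigcup_(s in [set s | (s < t)%N])
    ([set A s @^-1` [set x] | x in [set: I]] `|`
     [set Y s @^-1` B | B in measurable]).

Local Notation F t := <<s past t >>.
Local Notation TF t := (g_sigma_algebraType (past t)).

Hypotheses (Gm : G `<=` measurable) (mY : forall t, measurable_fun setT (Y t)).
Hypothesis adapted : forall t i, F t (A t @^-1` [set i]).

Lemma sub_past s t : (s <= t)%N -> F s `<=` F t.
Proof.
move=> st; apply: sub_sigma_algebra2 => E [GE|[r rs HE]]; first by left.
by right; exists r => //=; exact: leq_trans st.
Qed.

(** Strong induction is forced by adaptivity: arm [s] is known to be measurable only because it
    belongs to the past at [s]. *)
Lemma past_measurable t : F t `<=` measurable.
Proof.
elim/ltn_ind: t => t IH; apply: smallest_sub.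
  exact: sigma_algebra_measurable.
move=> E [/Gm//|[s st [[i _ <-]|[B mB <-]]]].
  by apply: (IH s st); exact: adapted.
by rewrite -[X in measurable X]setTI; exact: mY.
Qed.

Lemma past_arm s t i : (s <= t)%N -> F t (A s @^-1` [set i]).
Proof. by move=> st; by apply: (sub_past st); exact: adapted. Qed.

Lemma measurable_arm t i : measurable (A t @^-1` [set i]).
Proof. by apply: (@past_measurable t); exact: adapted. Qed.

Lemma past_setI t E E' : F t E -> F t E' -> F t (E `&` E').
Proof. exact: (@measurableI _ (TF t)). Qed.

Lemma measurable_past_obs s t : (s < t)%N -> measurable_fun setT (Y s : TF t -> R).
Proof.
move=> st _ B mB; rewrite setTI; apply: sub_sigma_algebra; right.
by exists s => //; right; exists B.
Qed.

Definition gaussian_arms (P : probability T R) (sd m : I -> R) :=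
  forall t i E (B : set R), F t E -> measurable B ->
    (P (E `&` A t @^-1` [set i] `&` [set w | B (Y t w - m i)%R]) =
     P (E `&` A t @^-1` [set i]) * normal_prob 0 (sd i) B)%E.

Lemma integral_gaussian_arms P sd m t i D (u : TF t -> \bar R) (h : R -> \bar R) :
    gaussian_arms P sd m -> F t D ->
    measurable_fun setT u -> (forall w, 0 <= u w)%E ->
    measurable_fun setT h -> (forall y, 0 <= h y)%E ->
  (\int[P]_(w in D `&` A t @^-1` [set i]) (u w * h (Y t w - m i)%R) =
   (\int[P]_(w in D `&` A t @^-1` [set i]) u w) *
   \int[normal_prob 0 (sd i)]_y h y)%E.
Proof.
move=> mod sD mu u0 mh h0.
apply: (@ge0_integral_indep _ _ _ P (past t) _ (fun w => Y t w - m i)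
  (normal_prob 0 (sd i))) => //.
- exact: past_measurable.
- by apply: past_setI => //; exact: adapted.
- exact: measurable_funB.
- by move=> E B sE mB; rewrite setIA; apply: mod => //; exact: past_setI.
Qed.

Variables (sd m m' : I -> R).
Hypothesis sd0 : forall i, sd i != 0.

(** The logarithm of the density of N(m' i, sd i ^ 2) relative to N(m i, sd i ^ 2), written in terms
    of the noise y - m i. *)
Definition llr (i : I) (y : R) : R :=
  ((m' i - m i) * (y - m i) - (m' i - m i) ^+ 2 / 2) / sd i ^+ 2.

Definition log_likelihood (t : nat) (w : T) : R :=
  \sum_(s < t) llr (A s w) (Y s w).

Lemma measurable_llr i : measurable_fun setT (llr i).
Proof.
apply: measurable_funM => //; apply: measurable_funB => //.
by apply: measurable_funM => //; exact: measurable_funB.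
Qed.

Lemma measurable_log_likelihood t :
  measurable_fun setT (log_likelihood t : TF t -> R).
Proof.
apply: measurable_sum => s.
rewrite (_ : (fun _ => _) = (fun w => \sum_i \1_(A s @^-1` [set i]) w * llr i (Y s w))).
  apply: measurable_sum => i; apply: measurable_funM.
    by apply: measurable_indic; apply: past_arm; exact: ltnW.
  apply: measurableT_comp; first exact: measurable_llr.
  exact: measurable_past_obs.
apply/funext => w; rewrite (bigD1 (A s w))//= indicE mem_set// mul1r big1 ?addr0//.
move=> i iA; rewrite indicE memNset ?mul0r//= => /eqP; rewrite eq_sym.
exact/negP.
Qed.

Lemma measurable_log_likelihoodT t : measurable_fun setT (log_likelihood t : T -> R).
Proof.
move=> _ B mB; apply: (@past_measurable t).
exact: (@measurable_log_likelihood t measurableT B mB).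
Qed.

Variables (P P' : probability T R).
Hypotheses (modP : gaussian_arms P sd m) (modP' : gaussian_arms P' sd m').
Hypothesis seedPP' : forall E, F 0 E -> P E = P' E.

(** Both sides are measures in [E]. In the induction step it suffices to compare them on the
    intersections of an event of [F t] with an event on [Y t]: these form a pi-system generating
    [F t.+1], since the arm pulled at [t] already belongs to [F t]. On such a set, split by that
    arm, the new observation contributes an independent Gaussian tilt. *)
Lemma change_of_measure t E : F t E ->
  P' E = (\int[P]_(w in E) (expR (log_likelihood t w))%:E)%E.
Proof.
elim: t E => [|t IH] E FE.
  rewrite -seedPP'// (eq_integral (cst 1%E)); last first.
    by move=> w _; rewrite /log_likelihood big_ord0 expR0.
  by rewrite integral_cst ?mul1e//; exact: (@past_measurable 0).
have mexp : measurable_fun setT (fun w => (expR (log_likelihood t.+1 w))%:E : \bar R).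
  apply/measurable_EFinP; apply: measurableT_comp => //.
  exact: measurable_log_likelihoodT.
have [|Q QE] := density_measure P mexp.
  by move=> w; rewrite lee_fin expR_ge0.
rewrite -QE.
pose C : set (set T) :=
  [set S | exists E B, [/\ F t E, measurable B & S = E `&` Y t @^-1` B]].
have mF := @past_measurable t.
have mYB B : measurable B -> measurable (Y t @^-1` B).
  by move=> mB; rewrite -[X in measurable X]setTI; exact: mY.
have Cm : C `<=` measurable.
  by move=> _ [E0 [B [FE0 mB ->]]]; apply: measurableI; [exact: mF|exact: mYB].
have FT s : F s setT by exact: (@measurableT _ (TF s)).
have FC0 E0 : F t E0 -> C E0.
  by move=> FE0; exists E0, setT; split => //; rewrite preimage_setT setIT.
have FC : F t.+1 `<=` <<s C >>.
  apply: sub_sigma_algebra2 => S [GS|[s st HS]].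
    by apply: FC0; apply: sub_sigma_algebra; left.
  move: st; rewrite /= ltnS leq_eqVlt => /predU1P[stE|st].
    subst s; case: HS => -[x].
      by move=> _ <-; apply: FC0; exact: adapted.
    by move=> mx <-; exists setT, x; split => //; rewrite setTI.
  by apply: FC0; apply: sub_sigma_algebra; right; exists s.
apply: (@g_sigma_algebra_measure_unique _ _ _ C Cm (fun=> setT)).
- by move=> _; exact: FC0.
- by rewrite bigcup_const//; exists 0%N.
- move=> _ _ [E1 [B1 [FE1 mB1 ->]]] [E2 [B2 [FE2 mB2 ->]]].
  exists (E1 `&` E2), (B1 `&` B2); split; [exact: past_setI|exact: measurableI|].
  by rewrite preimage_setI setIACA.
- move=> _ [E0 [B [FE0 mB ->]]].
  have mS : measurable (E0 `&` Y t @^-1` B) by apply: measurableI; [exact: mF|exact: mYB].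
  rewrite (measure_fin_partition P' (measurable_arm t))//.
  rewrite (measure_fin_partition Q (measurable_arm t))//.
  apply: eq_bigr => i _.
  have mshift c : measurable [set y : R | B (y + c)].
    rewrite -[X in measurable X]setTI.
    have mc : measurable_fun setT (fun y : R => y + c) by exact: measurable_funD.
    exact: mc.
  have FD : F t (E0 `&` A t @^-1` [set i]) by apply: past_setI => //; exact: adapted.
  transitivity (P' (E0 `&` A t @^-1` [set i]) * normal_prob 0 (sd i) [set y | B (y + m' i)%R])%E.
    rewrite -modP'//; congr (P' _); apply/seteqP.
    by split => w /=; rewrite subrK; tauto.
  rewrite QE IH//.
  (* The integrand splits into [u], known from the past, and [h], a function of the fresh noise;
     integrating [h] moves the mean from [m i] to [m' i]. *)
  pose u (w : TF t) : \bar R := (expR (log_likelihood t w))%:E.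
  pose h (y : R) : \bar R := (\1_[set y | B (y + m i)] y *
    expR (((m' i - m i) * y - (m' i - m i) ^+ 2 / 2) / sd i ^+ 2))%:E.
  have mu : measurable_fun setT u.
    by apply/measurable_EFinP; apply: measurableT_comp => //; exact: measurable_log_likelihood.
  have mh : measurable_fun setT h.
    apply/measurable_EFinP/measurable_funM => //.
    apply: measurableT_comp => //; apply: measurable_funM => //.
    by apply: measurable_funB => //; exact: measurable_funM.
  have u0 w : (0 <= u w)%E by rewrite lee_fin expR_ge0.
  have h0 y : (0 <= h y)%E by rewrite lee_fin mulr_ge0 ?expR_ge0.
  have := @integral_gaussian_arms P sd m t i E0 u h modP FE0 mu u0 mh h0.
  rewrite {2}/h (normal_prob_tilt (m' i - m i) (sd0 i) (mshift (m i))) => indep.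
  transitivity (\int[P]_(w in E0 `&` A t @^-1` [set i]) (u w * h (Y t w - m i)%R))%E.
    rewrite indep.
    congr (_ * _)%E; rewrite -(normal_prob_shift (m' i - m i))//.
    by congr (normal_prob _ _ _); apply/funext => y /=; rewrite -addrA subrK.
  rewrite setIAC integral_mkcondr; apply: eq_integral => w.
  rewrite inE => -[E0w Atw]; rewrite patchE /u /h -EFinM indicE.
  rewrite [_ \in [set _ | _]](_ : _ = (w \in Y t @^-1` B)); last first.
    by apply/idP/idP; rewrite !inE/= subrK.
  case: ifPn => _; last by rewrite mul0r mulr0.
  rewrite mul1r -expRD /log_likelihood big_ord_recr/=.
  by rewrite [A t w]Atw.
- by move=> _; rewrite -ge0_fin_numE//; exact: fin_num_measure.
- exact: FC.
Qed.

Lemma integral_noise t i D : F t D ->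
  let E := D `&` A t @^-1` [set i] in
  P.-integrable E (fun w => (Y t w - m i)%:E) /\
  (\int[P]_(w in E) (Y t w - m i)%:E = 0)%E.
Proof.
move=> FD E; have FE : F t E by apply: past_setI => //; exact: adapted.
have mE : measurable E by exact: (@past_measurable t).
pose f (w : T) : \bar R := (Y t w - m i)%:E.
have mf : measurable_fun E f.
  by apply: measurable_funTS; apply/measurable_EFinP; exact: measurable_funB.
have mEFin : measurable_fun setT (@EFin R) by apply/(@measurable_EFinP _ _ _ _ id).
have PE (h : R -> \bar R) : measurable_fun setT h -> (forall y, 0 <= h y)%E ->
    (\int[P]_(w in E) h (Y t w - m i)%R = P E * \int[normal_prob 0 (sd i)]_y h y)%E.
  move=> mh h0.
  have := @integral_gaussian_arms P sd m t i D (cst 1%E) h modP FD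
    (measurable_cst _) (fun=> lee01) mh h0.
  rewrite -/E integral_cst// mul1e => <-.
  by apply: eq_integral => w _; rewrite mul1e.
have [Neq Nlty] := normal_prob_funeposneg (sd0 i).
have Epos : (\int[P]_(w in E) f^\+ w = P E * \int[normal_prob 0 (sd i)]_y (@EFin R)^\+ y)%E.
  rewrite -(PE (@EFin R)^\+%E) ?funepos_ge0//; last exact: measurable_funepos.
  by apply: eq_integral => w _; rewrite !funeposE.
have Eneg : (\int[P]_(w in E) f^\- w = P E * \int[normal_prob 0 (sd i)]_y (@EFin R)^\+ y)%E.
  rewrite -Neq -(PE (@EFin R)^\-%E) ?funeneg_ge0//; last exact: measurable_funeneg.
  by apply: eq_integral => w _; rewrite !funenegE.
have fin : (P E * \int[normal_prob 0 (sd i)]_y (@EFin R)^\+ y)%E \is a fin_num.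
  rewrite fin_numM ?fin_num_measure// ge0_fin_numE//.
  by apply: integral_ge0 => y _; exact: funepos_ge0.
split; last by rewrite integralE Epos Eneg subee.
apply/integrableP; split => //.
rewrite -[X in integral _ _ X]/(abse \o f) fune_abse ge0_integralD//.
- by rewrite Epos Eneg -ge0_fin_numE ?fin_numD ?fin// adde_ge0// -?Epos integral_ge0.
- exact: measurable_funepos.
- exact: measurable_funeneg.
Qed.

Definition arm_kl (i : I) : R := (m' i - m i) ^+ 2 / (2 * sd i ^+ 2).

Lemma integral_llr t i D : F t D ->
  let E := D `&` A t @^-1` [set i] in
  P.-integrable setT (fun w => (\1_E w * llr i (Y t w))%:E) /\
  (\int[P]_w (\1_E w * llr i (Y t w))%:E = (- (arm_kl i * fine (P E)))%:E)%E.
Proof.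
move=> FD E; have FE : F t E by apply: past_setI => //; exact: adapted.
have mE : measurable E by exact: (@past_measurable t).
have [intN intN0] := integral_noise i FD.
pose a := (m' i - m i) / sd i ^+ 2.
pose g (w : T) : \bar R := (a%:E * (Y t w - m i)%:E + cst (- arm_kl i)%:E w)%E.
have int1 : P.-integrable E (fun w => a%:E * (Y t w - m i)%:E)%E by exact: integrableZl.
have int2 : P.-integrable E (cst (- arm_kl i)%:E).
  exact: finite_measure_integrable_cst.
have gE : (fun w => (\1_E w * llr i (Y t w))%:E) = g \_ E.
  apply/funext => w; rewrite patchE indicE; case: ifPn => _; last by rewrite mul0r.
  rewrite mul1r /g/= -EFinM -EFinD /llr /a /arm_kl; congr EFin; field.
  exact: sd0.
rewrite gE; split.
  exact: ((integrable_mkcond g mE).1 (integrableD mE int1 int2)).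
rewrite -integral_mkcond integralD// integralZl// intN0 mule0 add0e integral_cst//.
have PE : P E = (fine (P E))%:E by rewrite fineK ?fin_num_measure.
transitivity ((- arm_kl i)%:E * (fine (P E))%:E)%E; first by rewrite -PE.
by rewrite -EFinM mulNr.
Qed.

(** * Likelihood ratios up to a stopping time *)

Variable tau : T -> option nat.
Hypothesis tau_stop : forall t, F t (tau @^-1` [set Some t]).

(** The event s < tau, that is, pull [s] takes place: pulls are numbered from 0, so stopping at [t]
    means that pulls 0 to t - 1 were made. A run that never stops belongs to all of them. *)
Definition running (s : nat) : set T :=
  [set w | if tau w is Some t then (s < t)%N else true].

Lemma past_running s : F s (running s).
Proof.
rewrite (_ : running s = ~` \bigcup_(t in [set t | (t <= s)%N]) tau @^-1` [set Some t]).
  apply: (@measurableC _ (TF s)); apply: (@bigcup_measurable _ (TF s)) => t ts.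
  by apply: (sub_past ts); exact: tau_stop.
apply/seteqP; split => w; rewrite /running/=.
  by move=> tw [t ts twE]; move: tw; rewrite twE ltnNge ts.
case twE: (tau w) => [t|//] tw; rewrite ltnNge; apply/negP => ts.
by apply: tw; exists t.
Qed.

Definition sampled s i := running s `&` A s @^-1` [set i].

(** The log-likelihood at min(tau, n). Indicators in place of a random upper limit make its mean
    computable term by term. *)
Definition stopped_llr (n : nat) (w : T) : R :=
  \sum_(s < n) \sum_i (\1_(sampled s i) w * llr i (Y s w)).

Definition info (n : nat) : R :=
  \sum_(s < n) \sum_i (arm_kl i * fine (P (sampled s i))).

(** Wald's identity without optional stopping: whether pull [s] takes place and at which arm is
    decided before its noise, which has mean zero, so each term contributes minus [arm_kl i] times
    the probability of [sampled s i]. *)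
Lemma integral_stopped_llr n :
  P.-integrable setT (EFin \o stopped_llr n) /\
  (\int[P]_w (stopped_llr n w)%:E = (- info n)%:E)%E.
Proof.
have intL s i : P.-integrable setT (fun w => (\1_(sampled s i) w * llr i (Y s w))%:E) /\
    (\int[P]_w (\1_(sampled s i) w * llr i (Y s w))%:E =
     (- (arm_kl i * fine (P (sampled s i))))%:E)%E.
  exact: (@integral_llr s i (running s) (@past_running s)).
have sumE : EFin \o stopped_llr n =
  (fun w => \sum_(s < n) \sum_i (\1_(sampled s i) w * llr i (Y s w))%:E)%E.
  apply/funext => w; rewrite /= /stopped_llr -sumEFin.
  by apply: eq_bigr => s _; rewrite sumEFin.
have intS (s : nat) : P.-integrable setT
    (fun w => \sum_i (\1_(sampled s i) w * llr i (Y s w))%:E)%E.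
  by apply: integrable_sum => // i _; exact: (intL s i).1.
rewrite -[X in integral _ _ X]/(EFin \o stopped_llr n) sumE; split.
  by apply: integrable_sum => // s _; exact: intS.
rewrite integral_sum//.
rewrite /info -sumrN -sumEFin; apply: eq_bigr => s _.
rewrite integral_sum//; last by move=> i; exact: (intL s i).1.
by rewrite -sumrN -sumEFin; apply: eq_bigr => i _; exact: (intL s i).2.
Qed.

Lemma stopped_llrE n w t : (t <= n)%N ->
  (forall s, (s < n)%N -> running s w <-> (s < t)%N) ->
  stopped_llr n w = log_likelihood t w.
Proof.
move=> tn runP; rewrite /stopped_llr /log_likelihood.
rewrite -(big_mkord xpredT (fun s => llr (A s w) (Y s w))).
rewrite -(big_mkord xpredT (fun s => \sum_i (\1_(sampled s i) w * llr i (Y s w)))).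
rewrite (big_cat_nat (leq0n t) tn)/= [X in _ + X]big_nat_cond [X in _ + X]big1 ?addr0; last first.
  move=> s /andP[/andP[ts sn] _]; apply: big1 => i _; rewrite indicE memNset ?mul0r//.
  by case=> rs _; have := (runP s sn).1 rs; rewrite ltnNge ts.
rewrite big_nat_cond [RHS]big_nat_cond; apply: eq_bigr => s /andP[/andP[_ st] _].
rewrite (bigD1 (A s w))//= big1 ?addr0; last first.
  move=> i iA; rewrite indicE memNset ?mul0r//= => -[_ /eqP].
  by rewrite eq_sym (negbTE iA).
rewrite indicE mem_set ?mul1r//; split => //.
exact: (runP s (leq_trans st tn)).2 st.
Qed.

(** The hypotheses say that [H] is decided by time min(tau, n). On each piece where this time is
    constant, [change_of_measure] applies at that time. *)
Lemma stopped_change_of_measure n (H : set T) :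
    (forall t, (t <= n)%N -> F t (H `&` tau @^-1` [set Some t])) ->
    F n (H `&` running n) ->
  (\int[P]_(w in H) (expR (stopped_llr n w))%:E = P' H)%E.
Proof.
move=> Ht Hn.
pose K (k : nat) := if (k <= n)%N then H `&` tau @^-1` [set Some k] else H `&` running n.
have mK k : measurable (K k).
  rewrite /K; case: ifPn => [kn|_]; last exact: (@past_measurable n).
  by apply: (@past_measurable k); exact: Ht.
(* There are n + 2 pieces: stopping at 0, ..., n, and [running n], which has index n + 1. The
   abstract [N] keeps simplification from unfolding [iota]. *)
have [N NE] : exists N, N = n.+2 by exists n.+2.
have tK : trivIset [set` iota 0 N] K.
  apply/trivIsetP => /= i j; rewrite !mem_iota !add0n !leq0n NE/= => iN jN ij.
  apply/seteqP; split => w //; rewrite /K.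
  case: ifPn => [iln|niln]; case: ifPn => [jln|njln].
  - by move=> [[_ /=->] [_ /= [/eqP]]]; rewrite (negbTE ij).
  - by move=> [[_ /= twi] [_]]; rewrite /running/= twi ltnNge iln.
  - by move=> [[_ +] [_ /= twj]]; rewrite /running/= twj ltnNge jln.
  - move: ij; rewrite (_ : i = j) ?eqxx//; apply/eqP.
    rewrite !ltnS in iN jN; rewrite -!ltnNge in niln njln.
    by rewrite eqn_leq (leq_trans iN njln) (leq_trans jN niln).
have HE : H = \big[setU/set0]_(k <- iota 0 N) K k.
  rewrite -bigcup_seq; apply/seteqP; split => w; last first.
    by move=> [k _]; rewrite /K; case: ifPn => _ [].
  move=> Hw; have [rw|] := pselect (running n w).
    exists n.+1; first by rewrite /= mem_iota/= add0n NE ltnSn.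
    by rewrite /K ltnn.
  rewrite /running/=; case tw : (tau w) => [t|//] /negP; rewrite -leqNgt => tn.
  exists t; first by rewrite /= mem_iota/= add0n NE ltnS (leq_trans tn).
  by rewrite /K tn.
have mL : measurable_fun setT (fun w => (expR (stopped_llr n w))%:E : \bar R).
  apply/measurable_EFinP; apply: measurableT_comp => //.
  by apply/measurable_EFinP; exact: (measurable_int _ (integral_stopped_llr n).1).
rewrite {1}HE (ge0_integral_bigsetU P mK (iota_uniq 0 N) tK); last 2 first.
- exact: measurable_funTS.
- by move=> w _; rewrite lee_fin expR_ge0.
transitivity (\sum_(k <- iota 0 N) P' (K k))%E; last first.
  have mH : measurable H by rewrite HE; apply: bigsetU_measurable => k _.
  rewrite -[RHS]mul1e -(integral_cst P' mH) HE (ge0_integral_bigsetU P' mK (iota_uniq 0 N) tK)//.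
  by apply: eq_bigr => k _; rewrite integral_cst// mul1e.
apply: eq_big_seq => k _; rewrite /K; case: ifPn => [kn|_].
- rewrite (change_of_measure (Ht k kn)); apply: eq_integral => w.
  rewrite inE => -[_ /= tw]; congr (expR _)%:E; apply: stopped_llrE => // s _.
  by rewrite /running/= tw.
- rewrite (change_of_measure Hn); apply: eq_integral => w.
  rewrite inE => -[_ rw]; congr (expR _)%:E; apply: stopped_llrE => // s sn.
  split => // _; move: rw; rewrite /running/=; case: (tau w) => // t.
  exact: ltn_trans.
Qed.

Definition stopped_by (n : nat) : set T :=
  [set w | exists2 t, tau w = Some t & (t <= n)%N].

(** Jensen's inequality for L = a 1_En + [stopped_llr n], made pointwise: L <= exp (L - ln c) + ln c
    - 1, where c is the mean of exp L under [P]. By the change of measure, c is the mean of exp (a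
    1_En) under [P']. *)
Lemma information_ineq n E (a : R) : 0 <= a ->
    (forall t, F t (tau @^-1` [set Some t] `&` E)) ->
  a * fine (P (E `&` stopped_by n)) -
    ln (fine (P' (E `&` stopped_by n)) * expR a +
        (1 - fine (P' (E `&` stopped_by n)))) <= info n.
Proof.
(* [E] is observed only at the stop. Its part [En] is decided by time min(tau, n), and so is the
   complement, which contains all of [running n]. *)
move=> a0 FE; set En := E `&` stopped_by n.
have En_tau t : (t <= n)%N -> En `&` tau @^-1` [set Some t] = tau @^-1` [set Some t] `&` E.
  move=> tn; apply/seteqP; split => w /=; first by move=> [[]].
  by move=> [tw Ew]; split => //; split => //; exists t.
have En_run : En `&` running n = set0.
  apply/seteqP; split => w //= [[_ /= [t tw tn]]].
  by rewrite /running/= tw ltnNge tn.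
have Ent t : (t <= n)%N -> F t (En `&` tau @^-1` [set Some t]).
  by move=> tn; rewrite En_tau.
have Enn : F n (En `&` running n) by rewrite En_run; exact: (@measurable0 _ (TF n)).
have EnE : En = \bigcup_(t in [set t | (t <= n)%N]) (tau @^-1` [set Some t] `&` E).
  apply/seteqP; split => w /=.
    by move=> [Ew [t tw tn]]; exists t.
  by move=> [t tn [tw Ew]]; split => //; exists t.
have mEn : measurable En.
  rewrite EnE; apply: bigcup_measurable => t _.
  by apply: (@past_measurable t); exact: FE.
have EnCt t : (t <= n)%N -> F t (~` En `&` tau @^-1` [set Some t]).
  move=> tn; rewrite (_ : _ `&` _ = tau @^-1` [set Some t] `\` (En `&` tau @^-1` [set Some t])).
    by apply: (@measurableD _ (TF t)); [exact: tau_stop|exact: Ent].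
  by apply/seteqP; split => w /=; tauto.
have EnCn : F n (~` En `&` running n).
  rewrite (_ : _ `&` _ = running n); first exact: past_running.
  apply/seteqP; split => w /=; first by case.
  move=> rw; split => // Enw.
  have : (En `&` running n) w by [].
  by rewrite En_run.
have eEn := stopped_change_of_measure Ent Enn.
have eEnC := stopped_change_of_measure EnCt EnCn.
have [intZ intZE] := integral_stopped_llr n.
set p := fine (P En); set q := fine (P' En).
have PE : P En = p%:E by rewrite fineK ?fin_num_measure.
have P'E : P' En = q%:E by rewrite fineK ?fin_num_measure.
have P'CE : P' (~` En) = (1 - q)%:E.
  by rewrite probability_setC// P'E EFinB.
have q0 : 0 <= q by rewrite -lee_fin -P'E measure_ge0.
have q1 : 0 <= 1 - q by rewrite -lee_fin -P'CE measure_ge0.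
set c := q * expR a + (1 - q).
have c0 : 0 < c.
  have ea := expR_gt0 a; have ea1 : 1 <= expR a by rewrite -expR0 ler_expR.
  rewrite /c; nra.
pose L (w : T) : \bar R := (a * \1_En w + stopped_llr n w)%:E.
(* exp (L - ln c) + ln c - 1, with the exponential split along [En] and its complement, on each of
   which the change of measure gives the integral. *)
pose U (w : T) : \bar R :=
  ((c^-1 * expR a) * (\1_En w * expR (stopped_llr n w)) +
   c^-1 * (\1_(~` En) w * expR (stopped_llr n w)) + (ln c - 1))%:E.
have LU w : (L w <= U w)%E.
  rewrite lee_fin -lerBlDr opprB.
  have := expR_ge1Dx (a * \1_En w + stopped_llr n w - ln c).
  rewrite expRB expRD lnK ?posrE// => h.
  apply: le_trans (_ : expR (a * \1_En w) * expR (stopped_llr n w) / c <= _).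
    by apply: le_trans h; lra.
  rewrite !indicE in_setC; case: (w \in En) => /=; rewrite ?mulr1 ?mulr0 ?expR0.
    by rewrite le_eqVlt; apply/orP; left; apply/eqP; field; rewrite gt_eqF.
  by rewrite le_eqVlt; apply/orP; left; apply/eqP; field; rewrite gt_eqF.
have mexp : measurable_fun setT (fun w => expR (stopped_llr n w)).
  apply: measurableT_comp => //.
  by apply/measurable_EFinP; exact: (measurable_int _ intZ).
have intI (H : set T) (r : R) : measurable H ->
    (\int[P]_(w in H) (expR (stopped_llr n w))%:E = r%:E)%E ->
    P.-integrable setT (fun w => (\1_H w * expR (stopped_llr n w))%:E) /\
    (\int[P]_w (\1_H w * expR (stopped_llr n w))%:E = r%:E)%E.
  move=> mH HE.
  have E1 : (\int[P]_w (\1_H w * expR (stopped_llr n w))%:E = r%:E)%E.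
    rewrite -HE [RHS]integral_mkcond; apply: eq_integral => w _.
    by rewrite patchE indicE; case: ifPn => _; rewrite ?mul1r ?mul0r.
  split => //; apply/integrableP; split.
    by apply/measurable_EFinP; apply: measurable_funM.
  under eq_integral do rewrite gee0_abs ?lee_fin ?mulr_ge0 ?expR_ge0//.
  by rewrite E1 ltry.
have [i1 i1E] := intI _ _ mEn (etrans eEn P'E).
have [i2 i2E] := intI _ _ (measurableC mEn) (etrans eEnC P'CE).
have i3E : (\int[P]_w (\1_En w)%:E = p%:E)%E.
  by rewrite integral_indic// setIT; exact: PE.
have i3 : P.-integrable setT (fun w => (\1_En w)%:E).
  apply/integrableP; split; first exact/measurable_EFinP/measurable_indic.
  under eq_integral do rewrite gee0_abs ?lee_fin//.
  by rewrite i3E ltry.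
have i4 : P.-integrable setT (cst (ln c - 1)%:E).
  exact: finite_measure_integrable_cst.
have i4E : (\int[P]_w cst (ln c - 1)%:E w = (ln c - 1)%:E)%E.
  rewrite integral_cst// -[RHS]mule1; congr (_ * _)%E.
  exact: probability_setT.
have LE : L = (fun w => a%:E * (\1_En w)%:E + (EFin \o stopped_llr n) w)%E.
  by apply/funext => w; rewrite /L EFinD EFinM.
have UE : U = (fun w => ((c^-1 * expR a)%:E * (\1_En w * expR (stopped_llr n w))%:E +
   c^-1%:E * (\1_(~` En) w * expR (stopped_llr n w))%:E) + cst (ln c - 1)%:E w)%E.
  by apply/funext => w; rewrite /U !EFinD !EFinM.
have j1 := integrableZl measurableT a i3.
have j2 := integrableZl measurableT (c^-1 * expR a) i1.
have j3 := integrableZl measurableT c^-1 i2.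
have intL : P.-integrable setT L by rewrite LE; exact: (integrableD measurableT j1 intZ).
have intU : P.-integrable setT U.
  by rewrite UE; exact: (integrableD measurableT (integrableD measurableT j2 j3) i4).
have := le_integral measurableT intL intU (fun w _ => LU w).
rewrite LE UE.
rewrite (integralD measurableT j1 intZ) (integralD measurableT (integrableD measurableT j2 j3) i4).
rewrite (integralD measurableT j2 j3) !integralZl//.
rewrite i1E i2E i3E i4E intZE -!EFinM -!EFinD lee_fin => h.
have e1 : (c^-1 * expR a) * q + c^-1 * (1 - q) = 1.
  by rewrite -mulrA -mulrDr (mulrC (expR a)) -/c mulVf// gt_eqF.
by rewrite e1 in h; lra.
Qed.

Lemma measurable_running s : measurable (running s).
Proof. by apply: (@past_measurable s); exact: past_running. Qed.

Lemma measurable_stopped_by n : measurable (stopped_by n).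
Proof.
rewrite (_ : stopped_by n = ~` running n).
  by apply: measurableC; exact: measurable_running.
apply/seteqP; split => w; rewrite /stopped_by /running/=.
  by move=> [t -> tn]; rewrite ltnNge tn.
by case: (tau w) => [t|//] /negP; rewrite -leqNgt => tn; exists t.
Qed.

(** Markov's inequality for [tau]: the probabilities of [running s] decrease in [s], so the first n
    + 1 of them are at least the last. *)
Lemma prob_running_le n (B : R) :
    (forall k, \sum_(s < k) fine (P (running s)) <= B) ->
  n.+1%:R * fine (P (running n)) <= B.
Proof.
move=> HB; apply: le_trans (HB n.+1).
rewrite mulr_natl -[X in _ *+ X](card_ord n.+1) -sumr_const; apply: ler_sum => s _.
have mr := measurable_running.
apply: fine_le; [by apply: fin_num_measure; exact: mr..|].
apply: le_measure; rewrite ?inE; [exact: mr..|].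
move=> w; rewrite /running/=; case: (tau w) => // t.
by apply: leq_trans; rewrite ltnS -ltnS.
Qed.

(* Donsker-Varadhan at [a = 2 ln ((1 - delta) / delta)], for which
   [delta e^a + 1 - delta = (1 - delta) / delta]. *)
Lemma information_lower_bound E (delta B K : R) : 0 < delta -> delta < 5 / 12 ->
    measurable E -> ((1 - delta)%:E <= P E)%E -> (P' E <= delta%:E)%E ->
    (forall t, F t (tau @^-1` [set Some t] `&` E)) ->
    (forall k, \sum_(s < k) fine (P (running s)) <= B) ->
    (forall n, info n <= K) ->
  ln (1 / (24 / 10 * delta)) <= K.
Proof.
move=> d0 d1 mE PE P'E FE HB HK.
apply: le_trans (binary_kl_ge d0 d1) _.
set l := ln (1 - delta) - ln delta.
have l0 : 0 <= l by rewrite subr_ge0 ler_ln ?posrE; lra.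
have el : expR l = (1 - delta) / delta by rewrite expRB !lnK ?posrE; lra.
have B0 : 0 <= B by have := HB 0; rewrite big_ord0.
(* Without the term in [B] the left side is [(1 - 2 * delta) * l], the divergence between the
   Bernoulli laws with parameters 1 - delta and delta. The truncation costs
   [2 * l * B / n.+1%:R]. *)
have bound n : 2 * l * (1 - delta - B / n.+1%:R) - l <= K.
  have a0 : 0 <= 2 * l by lra.
  apply: le_trans (HK n); apply: le_trans (information_ineq n a0 FE).
  set En := E `&` stopped_by n.
  have mEn : measurable En by apply: measurableI => //; exact: measurable_stopped_by.
  have pn : 1 - delta - B / n.+1%:R <= fine (P En).
    have h1 : (P E <= P En + P (running n))%E.
      apply: le_trans (measureU2 _ mEn (measurable_running n)).
      apply: le_measure; rewrite ?inE//.
        by apply: measurableU => //; exact: measurable_running.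
      move=> w Ew; have [rw|nrw] := pselect (running n w); [by right|left].
      split => //; move: nrw; rewrite /running /stopped_by/=.
      by case: (tau w) => [t|//] /negP; rewrite -leqNgt => tn; exists t.
    have := le_trans PE h1.
    rewrite -[P En]fineK ?fin_num_measure// -[P (running n)]fineK ?fin_num_measure//; last exact: measurable_running.
    rewrite -EFinD lee_fin => h2.
    have h3 : fine (P (running n)) <= B / n.+1%:R.
      by rewrite ler_pdivlMr// mulrC; exact: prob_running_le.
    apply: le_trans (_ : 1 - delta - fine (P (running n)) <= _).
      by rewrite lerB.
    by rewrite lerBlDr.
  have qn : fine (P' En) <= delta.
    rewrite -lee_fin fineK ?fin_num_measure//; apply: le_trans P'E.
    by apply: le_measure; rewrite ?inE//; exact: subIsetl.
  have qn0 : 0 <= fine (P' En) by rewrite fine_ge0//; exact: measure_ge0.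
  have ea1 : 1 <= expR (2 * l) by rewrite -[leLHS]expR0 ler_expR.
  have e2 : delta * expR (2 * l) + (1 - delta) = (1 - delta) / delta.
    rewrite expRM_natl el; field; lra.
  rewrite lerB//; first exact: ler_wpM2l.
  rewrite [leRHS](_ : l = ln ((1 - delta) / delta)); last by rewrite -el expRK.
  rewrite ler_ln ?posrE; last 2 first.
  - apply: ltr_wpDl; first by rewrite mulr_ge0 ?expR_ge0.
    by rewrite subr_gt0 (le_lt_trans qn)//; lra.
  - by rewrite divr_gt0//; lra.
  rewrite -e2 -subr_ge0.
  rewrite (_ : _ - _ = (delta - fine (P' En)) * (expR (2 * l) - 1)); last by ring.
  by rewrite mulr_ge0// subr_ge0.
rewrite -/l leNgt; apply/negP => ltK.
have /archi_boundP : 0 <= 2 * l * B / ((1 - 2 * delta) * l - K).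
  by rewrite divr_ge0 ?mulr_ge0//; lra.
set n := Num.bound _ => nP; have := bound n.
set z := B / n.+1%:R.
have zlt : 2 * l * z < (1 - 2 * delta) * l - K.
  rewrite /z mulrA ltr_pdivrMr// -ltr_pdivrMl ?subr_gt0// mulrC.
  by apply: lt_le_trans nP _; rewrite ler_nat.
by rewrite leNgt => /negP; apply; lra.
Qed.

End adapted_sampling.

(** * Linear algebra of the design and of the alternatives *)

(** By continuity the strict inequalities persist on a ball around 0. The product of [ps] has fewer
    roots than its size, so among that many distinct points of the ball one is not a root. *)
Lemma poly_avoid (R : realType) (p1 p2 : {poly R}) (ps : seq {poly R}) :
    p1.[0] < 0 -> 0 < p2.[0] -> {in ps, forall p, p != 0} ->
  exists t, [/\ p1.[t] < 0, 0 < p2.[t] & {in ps, forall p, p.[t] != 0}].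
Proof.
move=> p10 p20 ps0; pose q := \prod_(p <- ps) p.
have q0 : q != 0.
  rewrite prodf_seq_neq0; apply/allP => p pps.
  by apply/implyP => _; exact: ps0.
have : \forall t \near (0 : R), p1.[t] < 0 /\ 0 < p2.[t].
  near=> t; split; near: t.
    exact: (cvgr_lt _ (@continuous_horner R p1 0) _ p10).
  exact: (cvgr_gt _ (@continuous_horner R p2 0) _ p20).
case=> e /= e0 ball_e.
pose r (k : nat) := e / k.+2%:R.
have r_inj : injective r.
  move=> i j /(mulfI (lt0r_neq0 e0))/invr_inj/eqP.
  by rewrite eqr_nat eqSS eqSS => /eqP.
have [/allP allroot|/allPn[_ /mapP[k _ ->] qk]] := boolP (all (root q) (map r (iota 0 (size q)))).
  have := max_poly_roots q0; move=> /(_ (map r (iota 0 (size q)))).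
  rewrite size_map size_iota ltnn map_inj_uniq// iota_uniq => H.
  by have := H _ isT; move=> /(_ (introT allP allroot)).
have [h1 h2] : p1.[r k] < 0 /\ 0 < p2.[r k].
  apply: ball_e; rewrite /= sub0r normrN gtr0_norm ?divr_gt0//.
  by rewrite ltr_pdivrMr// ltr_pMr// ltr1n.
exists (r k); split => // p pps.
by move: qk; rewrite root_bigmul => /allP/(_ _ pps).
Unshelve. all: by end_near. Qed.

(** * Inner products, the moment curve and the pseudoinverse *)

Section dot_theory.
Variables (R : realType) (d : nat).
Implicit Types (u v w : 'cV[R]_d) (A B : 'M[R]_d).

Lemma dotE u v : dot u v = \sum_k u k 0 * v k 0.
Proof. by rewrite /dot mxE; apply: eq_bigr => k _; rewrite mxE. Qed.

Lemma dotC u v : dot u v = dot v u.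
Proof. by rewrite !dotE; apply: eq_bigr => k _; rewrite mulrC. Qed.

Lemma dotDr u v w : dot u (v + w) = dot u v + dot u w.
Proof. by rewrite /dot mulmxDr mxE. Qed.

Lemma dotNr u v : dot u (- v) = - dot u v.
Proof. by rewrite /dot mulmxN mxE. Qed.

Lemma dotBr u v w : dot u (v - w) = dot u v - dot u w.
Proof. by rewrite dotDr dotNr. Qed.

Lemma dotZr u v a : dot u (a *: v) = a * dot u v.
Proof. by rewrite /dot -scalemxAr mxE. Qed.

Lemma dotDl u v w : dot (u + v) w = dot u w + dot v w.
Proof. by rewrite dotC dotDr !(dotC w). Qed.

Lemma dotBl u v w : dot (u - v) w = dot u w - dot v w.
Proof. by rewrite dotC dotBr !(dotC w). Qed.

Lemma dot0l u : dot 0 u = 0.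
Proof. by rewrite /dot trmx0 mul0mx mxE. Qed.

Lemma dot_mulmxr A u v : dot u (A *m v) = dot (A^T *m u) v.
Proof. by rewrite /dot trmx_mul trmxK mulmxA. Qed.

Lemma dot_eq0 u : dot u u = 0 -> u = 0.
Proof.
rewrite dotE => /eqP; rewrite psumr_eq0; last by move=> k _; rewrite -expr2 sqr_ge0.
move=> /allP u0; apply/colP => k; have := u0 k (mem_index_enum k).
by rewrite mulf_eq0 orbb mxE => /eqP.
Qed.

(** Starting at exponent 1 makes the curve pass through the origin at t = 0 and keeps the constant
    coefficient free: along it a nonzero linear form plus any constant is a nonzero polynomial. *)
Definition moment_curve (t : R) : 'cV[R]_d := \col_k t ^+ k.+1.

Definition moment_poly (a : 'cV[R]_d) : {poly R} := \poly_(k < d.+1)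
  (if k is k'.+1 then (if insub k' is Some i then a i 0 else 0) else 0).

Lemma moment_polyE a t : (moment_poly a).[t] = dot a (moment_curve t).
Proof.
rewrite horner_poly big_ord_recl/= mul0r add0r dotE.
apply: eq_bigr => k _; rewrite mxE; congr (_ * _).
by rewrite /= (valK k).
Qed.

Lemma moment_poly_neq0 a c : a != 0 -> moment_poly a + c%:P != 0.
Proof.
move=> a0; have [k ak] : exists k, a k 0 != 0.
  apply/existsP; apply: contraNT a0 => /existsPn H; apply/eqP/colP => k.
  by have := H k; rewrite negbK mxE => /eqP.
apply/eqP => /(congr1 (fun p : {poly R} => p`_k.+1)).
rewrite coefD coefC coef_poly/= addr0 ltnS ltn_ord (valK k) coef0 => /eqP.
by rewrite (negbTE ak).
Qed.

Lemma mulmx_pinv_sym B : B^T = B -> B *m (B *m pinv B) = B.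
Proof.
move=> BT; have [B1 _ BG _] := pinvP B.
have -> : B *m pinv B = (pinv B)^T *m B by rewrite -{1}BG trmx_mul BT.
have : (B *m pinv B *m B)^T = B by rewrite B1.
by rewrite !trmx_mul BT.
Qed.

(** For symmetric [B], [B *m pinv B] is the orthogonal projection onto the range. The residual u of
    [v] is killed by [B], and <v, u> = |u|^2 vanishes only when [v] is in the range. *)
Lemma range_mx_or_ker B v : B^T = B ->
  range_mx B v \/ exists u, B *m u = 0 /\ dot v u != 0.
Proof.
move=> BT; have [B1 _ BG _] := pinvP B.
pose w := B *m (pinv B *m v); pose u := v - w.
have Bu : B *m u = 0.
  by rewrite /u mulmxBr /w (mulmxA B (pinv B)) mulmxA mulmx_pinv_sym// subrr.
have vu : dot v u = dot u u.
  rewrite {1}(_ : v = u + w); last by rewrite subrK.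
  rewrite dotDl (_ : dot w u = 0) ?addr0// dotC /w dot_mulmxr BT Bu.
  exact: dot0l.
have [u0|u0] := eqVneq u 0; [left|right].
  by exists (pinv B *m v); apply/eqP; rewrite -subr_eq0 -/u u0.
by exists u; split => //; rewrite vu; apply: contra u0 => /eqP/dot_eq0 ->.
Qed.

Lemma quad_pinv B v : B^T = B -> range_mx B v ->
  quad B (pinv B *m v) = quad (pinv B) v /\
  dot v (pinv B *m v) = quad (pinv B) v.
Proof.
move=> BT [y ->]; have [B1 _ _ _] := pinvP B; split => //.
by rewrite /quad (mulmxA B (pinv B)) (mulmxA (B *m pinv B) B) B1 dotC.
Qed.

Lemma quadZ B a v : quad B (a *: v) = a ^+ 2 * quad B v.
Proof. by rewrite /quad -scalemxAr dotZr dotC dotZr dotC mulrA. Qed.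

(* Testing the hypothesis on [u] proportional to [B^+ v] is optimal when [v] is
   in the range of [B]; otherwise a multiple of a kernel vector refutes it. *)
Lemma inv_norm2_le B v (c T gap : R) : B^T = B -> (forall u, 0 <= quad B u) ->
    0 < c -> 0 < gap -> 0 <= T ->
    (forall u, gap < dot v u -> c <= T * quad B u) ->
  (inv_norm2 B v <= (T * gap ^+ 2 / c)%:E)%E.
Proof.
move=> BT B0 c0 gap0 T0 H; rewrite /inv_norm2.
case: (range_mx_or_ker v BT) => [vB|[u [Bu vu]]]; last first.
  have := H (((gap + 1) / dot v u) *: u); rewrite dotZr divfK// ltrDl ltr01.
  move=> /(_ isT); rewrite quadZ /quad Bu [dot u 0]dotC dot0l !mulr0.
  by rewrite leNgt c0.
rewrite mem_set// lee_fin ler_pdivlMr//.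
have [qE dE] := quad_pinv BT vB.
set r := quad (pinv B) v in qE dE *.
have r0 : 0 <= r by rewrite -qE.
have [->|rN0] := eqVneq r 0; first by rewrite mul0r mulr_ge0// sqr_ge0.
have rgt0 : 0 < r by rewrite lt_def rN0.
have H' g : gap < g -> r * c <= T * g ^+ 2.
  move=> gg; have := H ((g / r) *: (pinv B *m v)).
  rewrite dotZr dE divfK// => /(_ gg); rewrite quadZ qE => h.
  have := ler_wpM2l r0 h.
  by rewrite (_ : r * (T * _) = T * g ^+ 2)//; field.
(* The limit of [H'] as [g] decreases to [gap]: otherwise [s], the square root of [r * c / T],
   exceeds [gap], and the midpoint of the two contradicts [H']. *)
rewrite leNgt; apply/negP => lt.
have Tgt0 : 0 < T.
  rewrite lt_def T0 andbT; apply/eqP => T_eq0.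
  have := H' (gap + 1); rewrite ltrDl ltr01 => /(_ isT).
  by rewrite T_eq0 mul0r leNgt mulr_gt0.
have lt' : gap ^+ 2 < r * c / T by rewrite ltr_pdivlMr// mulrC.
set s := Num.sqrt (r * c / T).
have s2 : s ^+ 2 = r * c / T by rewrite sqr_sqrtr// ltW// divr_gt0// mulr_gt0.
have gs : gap < s.
  rewrite -(@ltr_pXn2r _ 2)// ?nnegrE ?sqrtr_ge0 ?(ltW gap0)//.
  by rewrite s2.
have /H' : gap < (gap + s) / 2 by lra.
have -> : r * c = T * s ^+ 2 by rewrite s2 [T * _]mulrC divfK// gt_eqF.
rewrite ler_pM2l// ler_pXn2r ?nnegrE//; last 2 first.
- by rewrite sqrtr_ge0.
- by rewrite divr_ge0// addr_ge0 ?sqrtr_ge0// ltW.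
by rewrite ler_pdivlMr//; lra.
Qed.
End dot_theory.

Section design.
Variables (R : realType) (d : nat) (X : {fset 'cV[R]_d}) (Sigma : 'M[R]_d).
Implicit Types (lam : {ffun X -> R}).

Lemma quad_design_mx lam u : quad (design_mx Sigma lam) u =
  \sum_(x : X) lam x / quad Sigma (val x) * dot (val x) u ^+ 2.
Proof.
rewrite {1}/quad /dot /design_mx mulmxA mulmx_sumr mulmx_suml summxE.
apply: eq_bigr => x _.
rewrite -scalemxAr -scalemxAl mxE; congr (_ * _).
rewrite mulmxA -(mulmxA (u^T *m val x)) mxE big_ord1 expr2; congr (_ * _).
exact: dotC.
Qed.

Lemma design_mx_sym lam : (design_mx Sigma lam)^T = design_mx Sigma lam.
Proof.
rewrite /design_mx raddf_sum/=; apply: eq_bigr => x _.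
by rewrite linearZ/= trmx_mul trmxK.
Qed.
End design.

(** * Alternatives and their perturbation into the parameter space *)

Section objectives.
Variables (R : realType) (d : nat) (Z : {fset 'cV[R]_d}) (alpha : R).
Implicit Types (theta : 'cV[R]_d) (obj : objective).

Lemma argmax_setP theta z : reflect
  (z \in Z /\ forall z', z' \in Z -> dot z' theta <= dot z theta)
  (z \in argmax_set Z theta).
Proof.
rewrite /argmax_set !inE; apply: (iffP andP) => -[zZ zmax]; split => //.
  by move=> z' z'Z; have /forallP/(_ [` z'Z]%fset) := zmax.
by apply/forallP => z'; exact/zmax/valP.
Qed.

Lemma argmax_set_singleton theta : Z != fset0 ->
    {in Z &, forall z z', z != z' -> dot z theta != dot z' theta} ->
  exists z, argmax_set Z theta = [fset z]%fset.
Proof.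
case/fset0Pn => z0 z0Z inj.
pose f (z : Z) := dot (val z) theta.
have [z _ zmax] := arg_maxP f (isT : xpredT [` z0Z]%fset).
exists (val z); apply/fsetP => z'; rewrite inE; apply/argmax_setP/eqP.
  move=> [z'Z z'max]; apply: contraTeq isT => zz'.
  have := inj _ _ z'Z (valP z) zz'; rewrite eq_le z'max ?(valP z)// andbT.
  by have /= := zmax [` z'Z]%fset isT; rewrite /f/= => ->.
move=> ->; split; first exact: valP.
by move=> z'' z''Z; have := zmax [` z''Z]%fset isT.
Qed.

Lemma gap_gt0 obj theta h q :
    h \in Hset obj Z alpha theta -> q \in Qset obj Z theta ->
  0 < dot (h - q) theta - offset obj alpha.
Proof.
case: obj => /=.
  rewrite subr0 dotBl subr_gt0 => /argmax_setP[hZ hmax].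
  rewrite in_fsetD => /andP[qmax qZ]; rewrite lt_neqAle hmax// andbT.
  apply: contra qmax => /eqP qh; apply/argmax_setP; split => // z' z'Z.
  by rewrite qh hmax.
rewrite !inE => /andP[_ ha] /eqP ->.
by rewrite subr0 subr_gt0.
Qed.

(* [theta - u] may lie outside [Theta]; a short step along the moment curve, which
   meets each of the excluded hyperplanes finitely often, brings it back. *)
Lemma alternative_closure obj theta h q (I : finType) (x : I -> 'cV[R]_d)
    (k : I -> R) (c : R) :
    Theta obj Z alpha theta ->
    h \in Hset obj Z alpha theta -> q \in Qset obj Z theta ->
    (forall theta', Theta obj Z alpha theta' ->
      h \notin Hset obj Z alpha theta' ->
      c <= \sum_i k i * dot (x i) (theta - theta') ^+ 2) ->
  forall u, dot (h - q) theta - offset obj alpha < dot (h - q) u ->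
  c <= \sum_i k i * dot (x i) u ^+ 2.
Proof.
move=> theta_in hH qQ alt u ugap; rewrite leNgt; apply/negP => ltc.
pose theta' t := theta - u + moment_curve d t : 'cV[R]_d.
have cur0 : moment_curve d 0 = 0 :> 'cV[R]_d.
  by apply/colP => i; rewrite !mxE expr0n.
pose p1 := \sum_i k i *: ((dot (x i) u)%:P - moment_poly (x i)) ^+ 2 - c%:P.
have p1E t : p1.[t] = \sum_i k i * dot (x i) (theta - theta' t) ^+ 2 - c.
  rewrite /p1 hornerD hornerN hornerC horner_sum; congr (_ - _).
  apply: eq_bigr => i _; rewrite hornerZ horner_exp hornerD hornerN hornerC.
  rewrite moment_polyE -dotBr; congr (_ * dot _ _ ^+ 2).
  by rewrite /theta' opprD opprB addrA [theta + _]addrC subrK.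
pose p2 := (dot (h - q) u - (dot (h - q) theta - offset obj alpha))%:P
  - moment_poly (h - q).
have p2E t : p2.[t] = offset obj alpha - dot (h - q) (theta' t).
  by rewrite /p2 hornerD hornerN hornerC moment_polyE /theta' dotDr dotBr; lra.
(* The hyperplanes to avoid. For [BAI] all ties between two elements of [Z] are excluded, which is
   more than uniqueness of the maximizer. *)
pose ps : seq {poly R} := match obj with
  | BAI => [seq moment_poly (z.1 - z.2) + (dot (z.1 - z.2) (theta - u))%:P |
      z <- [seq (z, z') | z <- enum_fset Z, z' <- enum_fset Z] & z.1 != z.2]
  | LS => [seq moment_poly z + (dot z (theta - u) - alpha)%:P | z <- enum_fset Z]
  end.
have ps0 : {in ps, forall p, p != 0}.
  rewrite /ps; case: (obj) theta_in => /=.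
    move=> _ p /mapP[[z z']]; rewrite mem_filter/= => /andP[zz' _] ->.
    by apply: moment_poly_neq0; rewrite subr_eq0.
  move=> theta_in p /mapP[z zZ ->].
  (* For z = 0 the polynomial is the constant -alpha; it is nonzero because [theta] is in [Theta]
     and 0 is in [Z]. *)
  have [z0|] := eqVneq z 0; last exact: moment_poly_neq0.
  apply/eqP => /(congr1 (horner^~ 0)).
  rewrite hornerD hornerC moment_polyE hornerC z0 !dot0l add0r sub0r => /eqP.
  rewrite oppr_eq0 => /eqP a0.
  by apply: (theta_in z zZ); rewrite z0 dot0l a0.
have [||t [p1t p2t pst]] := poly_avoid _ _ ps0 (p1 := p1) (p2 := p2).
- rewrite p1E /theta' cur0 addr0 subr_lt0 (le_lt_trans _ ltc)//.
  by rewrite opprB addrC subrK.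
- rewrite p2E /theta' cur0 addr0 dotBr; lra.
have theta'_in : Theta obj Z alpha (theta' t).
  move: pst; rewrite /ps; case: (obj) theta_in hH qQ => /=.
    move=> [z0 z0E] _ _ pst; apply: argmax_set_singleton.
      apply/fset0Pn; exists z0.
      have : z0 \in argmax_set Z theta by rewrite z0E inE.
      by case/argmax_setP.
    move=> z z' zZ z'Z zz'.
    have pE : (moment_poly (z - z') + (dot (z - z') (theta - u))%:P).[t] =
        dot z (theta' t) - dot z' (theta' t).
      by rewrite hornerD hornerC moment_polyE addrC -dotDr dotBl.
    rewrite -subr_eq0 -pE; apply: pst.
    apply/mapP; exists (z, z') => //; rewrite mem_filter/= zz'.
    by apply: allpairs_f.
  move=> _ _ _ pst z zZ.
  have pE : (moment_poly z + (dot z (theta - u) - alpha)%:P).[t] =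
      dot z (theta' t) - alpha.
    by rewrite hornerD hornerC moment_polyE /theta' [in RHS](dotDr z (theta - u)); lra.
  by apply/eqP; rewrite -subr_eq0 -pE; apply: pst; exact: map_f.
have hH' : h \notin Hset obj Z alpha (theta' t).
  move: p2t; rewrite p2E; case: (obj) qQ => /=.
    rewrite in_fsetD => /andP[_ qZ]; rewrite dotBl => lt0.
    by apply/argmax_setP => -[_ /(_ q qZ)]; rewrite leNgt; apply/negP; rewrite negbK; lra.
  rewrite !inE => /eqP ->; rewrite subr0 subr_gt0 => lta.
  by rewrite negb_and -leNgt (ltW lta) orbT.
by have := alt _ theta'_in hH'; rewrite -subr_ge0 -p1E leNgt p1t.
Qed.
End objectives.

(** * The lower bound *)

(** The tail-sum formula: it turns E[tau] into the series of the probabilities of [running s], with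
    value +oo on runs that never stop. *)
Lemma pulls_nneseries (R : realType) (d : nat) (X : {fset 'cV[R]_d})
    (disp : measure_display) (Omega : measurableType disp)
    (Y : nat -> {mfun Omega >-> R}) (alg : algorithm X Y) (w : Omega) :
  pulls alg w = (\sum_(s <oo) (\1_(running (tau alg) s) w)%:E)%E.
Proof.
rewrite /pulls.
pose b s : bool := if tau alg w is Some t then (s < t)%N else true.
have bE s : (w \in running (tau alg) s) = b s.
  by apply/idP/idP; rewrite inE /running /b/=; case: (tau alg w).
have runE s : \1_(running (tau alg) s) w = (b s)%:R :> R by rewrite indicE bE.
rewrite /b in runE.
case: (tau alg w) runE => [n|] runE.
  rewrite (nneseries_split 0 n)//.
  rewrite [X in (_ + X)%E](_ : _ = 0%E) ?adde0; last first.
    apply: eseries0 => k nk _; rewrite runE ltnNge.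
    by move: nk; rewrite add0n => ->.
  rewrite add0n sumEFin big_mkord; congr EFin.
  rewrite (eq_bigr (fun=> 1)); last by move=> i _; rewrite runE ltn_ord.
  by rewrite sumr_const card_ord.
apply/esym/eq_infty => B.
apply: le_trans (nneseries_lim_ge (Num.bound `|B|) _); last by move=> *; rewrite lee_fin.
rewrite sumEFin big_mkord lee_fin (eq_bigr (fun=> 1)); last by move=> i _; rewrite runE.
rewrite sumr_const card_ord; apply: le_trans (ler_norm B) _.
by rewrite ltW// archi_boundP.
Qed.

Lemma design_value_ge0 (R : realType) (d : nat) (X Z : {fset 'cV[R]_d})
    (Sigma : 'M[R]_d) obj alpha theta (lam : {ffun X -> R}) :
  (0 <= design_value Sigma obj Z alpha theta lam)%E.
Proof. exact: bigmax_ge_id. Qed.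

Theorem theorem4p1 (R : realType) (d : nat)
    (X Z : {fset 'cV[R]_d}) (Sigma : 'M[R]_d) (alpha delta : R)
    (obj : objective)
    (hspan : <<enum_fset X>>%VS = fullv)
    (hZ : obj = BAI -> (2 <= #|` Z|)%N)
    (hSigma : psd Sigma)
    (hsigma : forall x, x \in X -> 0 < quad Sigma x)
    (hdelta : 0 < delta < 1)
    (disp : measure_display) (Omega : measurableType disp)
    (Y : nat -> {mfun Omega >-> R}) (alg : algorithm X Y)
    (P : 'cV[R]_d -> probability Omega R)
    (hmodel : heteroskedastic_model alg Sigma P)
    (hpac : pac alg obj Z alpha delta P)
    (theta : 'cV[R]_d) (htheta : Theta obj Z alpha theta) :
  ((2 * ln (1 / (24 / 10 * delta)))%:E * psi_star X Sigma obj Z alpha theta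
   <= \int[P theta]_w pulls alg w)%E.
Proof.
have [d0 d1] := andP hdelta.
have int_ge0 : (0 <= \int[P theta]_w pulls alg w)%E.
  by apply: integral_ge0 => w _; rewrite /pulls; case: (tau alg w).
have psi_ge0 : (0 <= psi_star X Sigma obj Z alpha theta)%E.
  by apply: le_ereal_inf_tmp => _ [lam _ <-]; exact: design_value_ge0.
have [C0|Cgt0] := leP (ln (1 / (24 / 10 * delta))) 0.
  apply: le_trans int_ge0; apply: mule_le0_ge0 => //.
  by rewrite lee_fin mulr_ge0_le0.
set C := ln _ in Cgt0 *.
have d5 : delta < 5 / 12.
  rewrite ltNge; apply/negP => d5; move: Cgt0; apply/negP; rewrite -leNgt.
  by apply: ln_le0; rewrite ler_pdivrMr; lra.
have [->|Ioo] := eqVneq (\int[P theta]_w pulls alg w)%E +oo%E; first exact: leey.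
have Ifin : (\int[P theta]_w pulls alg w)%E \is a fin_num.
  by rewrite ge0_fin_numE// ltey.
have q0 (x : X) : 0 < quad Sigma (val x) by exact: (hsigma _ (valP x)).
pose sd (x : X) := Num.sqrt (quad Sigma (val x)).
have sd2 x : sd x ^+ 2 = quad Sigma (val x) by rewrite sqr_sqrtr// ltW.
have sd0 x : sd x != 0 by rewrite gt_eqF// /sd sqrtr_gt0.
pose Yf n : Omega -> R := Y n.
have mY t : measurable_fun setT (Yf t) by exact: measurable_funPT.
have Gm := @seed_measurable _ _ _ _ _ _ alg.
have adapted : forall t i, <<s past (seed alg) (arm alg) Yf t >> (arm alg t @^-1` [set i]).
  exact: arm_adapted.
have stop : forall t, <<s past (seed alg) (arm alg) Yf t >> (tau alg @^-1` [set Some t]).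
  exact: tau_stopping.
have model th : gaussian_arms (seed alg) (arm alg) Yf (P th) sd (fun x => dot (val x) th).
  by move=> t x E B FE mB; exact: hmodel.2.
have seedP th th' E : <<s past (seed alg) (arm alg) Yf 0 >> E -> P th E = P th' E.
  move=> FE; apply: hmodel.1; move: E FE; apply: smallest_sub.
    exact: seed_sigma_algebra.
  by move=> E [//|[s]].
have mrun := measurable_running Gm mY adapted stop.
have runE : (\sum_(s <oo) P theta (running (tau alg) s) = \int[P theta]_w pulls alg w)%E.
  rewrite (eq_integral (fun w => \sum_(s <oo) (\1_(running (tau alg) s) w)%:E)%E); last first.
    by move=> w _; exact: pulls_nneseries.
  rewrite integral_nneseries//; last first.
    by move=> s; apply/measurable_EFinP/measurable_indic; exact: mrun.
  by apply: eq_eseriesr => s _; rewrite integral_indic ?setIT//; exact: mrun.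
pose S x s := sampled (arm alg) (tau alg) s x.
have mS x s : measurable (S x s).
  by apply: measurableI; [exact: mrun|exact: (measurable_arm Gm mY adapted)].
pose W x : \bar R := (\sum_(s <oo) P theta (S x s))%E.
have W0 x : (0 <= W x)%E by exact: nneseries_ge0.
have sumW : (\sum_x W x = \int[P theta]_w pulls alg w)%E.
  rewrite -runE -nneseries_sum//; apply: eq_eseriesr => s _.
  rewrite (measure_fin_partition _ (measurable_arm Gm mY adapted s))//.
have Wfin x : W x \is a fin_num.
  rewrite ge0_fin_numE// (le_lt_trans _ (_ : \int[P theta]_w pulls alg w < +oo)%E)//.
    by rewrite -sumW (bigD1 x)//= leeDl// sume_ge0.
  by rewrite ltey.
pose w x := fine (W x).
have w0 x : 0 <= w x by exact: fine_ge0.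
pose T := fine (\int[P theta]_w pulls alg w)%E.
have T0 : 0 <= T by exact: fine_ge0.
have sumw : \sum_x w x = T.
  apply: EFin_inj; rewrite -sumEFin /T fineK// -sumW.
  by apply: eq_bigr => x _; rewrite fineK.
(* [T * lam x = w x] avoids a division and also covers [T = 0]: there all weights vanish and any
   distribution will do, here the point mass at the arm read off at the canonical point of
   [Omega]. *)
have [lam [lam_distr lamE]] : exists lam : {ffun X -> R},
    distributions lam /\ forall x, T * lam x = w x.
  have [T_eq0|TN0] := eqVneq T 0.
    pose x0 := arm alg 0 point.
    exists [ffun x => (x == x0)%:R]; split.
      split; first by move=> x; rewrite ffunE.
      rewrite (bigD1 x0)//= ffunE eqxx big1 ?addr0// => x xx0.
      by rewrite ffunE (negbTE xx0).
    move: sumw; rewrite T_eq0 => /eqP; rewrite psumr_eq0// => /allP wx x.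
    by rewrite mul0r; have /eqP -> := wx x (mem_index_enum x).
  exists [ffun x => w x / T]; split.
    split; first by move=> x; rewrite ffunE divr_ge0.
    under eq_bigr do rewrite ffunE.
    by rewrite -mulr_suml sumw divff.
  by move=> x; rewrite ffunE mulrC divfK.
have key : (psi_star X Sigma obj Z alpha theta <= (T / (2 * C))%:E)%E.
  apply: le_trans (_ : design_value Sigma obj Z alpha theta lam <= _)%E.
    by apply: ereal_inf_lbound; exists lam.
  have TC0 : (0 <= (T / (2 * C))%:E)%E.
    by rewrite lee_fin divr_ge0// mulr_ge0// ltW.
  rewrite /design_value big_seq; apply: bigmax_le => // h hH.
  rewrite big_seq; apply: bigmax_le => // q qQ.
  have gap0 := gap_gt0 hH qQ.
  set gap := dot (h - q) theta - offset obj alpha in gap0 *.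
  have alt theta' : Theta obj Z alpha theta' -> h \notin Hset obj Z alpha theta' ->
      C <= \sum_(x : X) w x / (2 * quad Sigma (val x)) * dot (val x) (theta - theta') ^+ 2.
    move=> htheta' hN.
    pose E := Hhat alg @^-1` [set Hset obj Z alpha theta].
    have mE : measurable E by exact: Hhat_measurable.
    apply: (information_lower_bound (B := T) Gm mY adapted sd0 (model theta)
      (model theta') (seedP theta theta') stop (E := E) d0 d5) => //.
    - exact: hpac.
    - have mE' : measurable (Hhat alg @^-1` [set Hset obj Z alpha theta']).
        exact: Hhat_measurable.
      (* [h] belongs to the right answer for [theta] but not to that for [theta'], so the answer
         tested by [E] is an error under [theta']. *)
      apply: le_trans (_ : P theta' (~` (Hhat alg @^-1` [set Hset obj Z alpha theta'])) <= _)%E.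
        apply: le_measure; rewrite ?inE//; first exact: measurableC.
        move=> om /= -> HH; move: hN; rewrite -HH hH; by [].
      rewrite probability_setC//; have := hpac _ htheta'.
      rewrite -[P theta' _]fineK ?fin_num_measure// -EFinB !lee_fin.
      by rewrite lerBlDr lerBlDl.
    - move=> t; exact: Hhat_adapted.
    - move=> k; rewrite -lee_fin -sumEFin /T fineK// -runE.
      rewrite -(big_mkord xpredT (fun s => (fine (P theta (running (tau alg) s)))%:E)).
      apply: le_trans (nneseries_lim_ge k _) => //.
      by apply: lee_sum => s _; rewrite fineK// fin_num_measure//; exact: mrun.
    - move=> n; rewrite /info exchange_big/=; apply: ler_sum => x _.
      rewrite -mulr_sumr /arm_kl sd2 mulrC [leRHS]mulrAC -mulrA.
      rewrite -dotBr -[dot _ (theta - _)]opprK -dotNr opprB sqrrN.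
      apply: ler_wpM2r.
        by rewrite divr_ge0 ?sqr_ge0// mulr_ge0// ltW.
      rewrite -lee_fin /w fineK// -sumEFin.
      rewrite -(big_mkord xpredT (fun s => (fine (P theta (S x s)))%:E)).
      apply: le_trans (nneseries_lim_ge n _) => //.
      by apply: lee_sum => s _; rewrite fineK// fin_num_measure.
  have closure := alternative_closure htheta hH qQ alt.
  (* The factor 2 of the Gaussian divergence appears here and becomes the 2 in front of the
     logarithm. *)
  have quadE u : T * quad (design_mx Sigma lam) u =
      2 * \sum_(x : X) w x / (2 * quad Sigma (val x)) * dot (val x) u ^+ 2.
    rewrite quad_design_mx !mulr_sumr; apply: eq_bigr => x _.
    by rewrite -lamE; field; rewrite gt_eqF.
  have H1 u : 0 <= quad (design_mx Sigma lam) u.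
    rewrite quad_design_mx; apply: sumr_ge0 => x _.
    rewrite mulr_ge0 ?sqr_ge0// divr_ge0//; first exact: lam_distr.1.
    by rewrite ltW.
  have H2 u : gap < dot (h - q) u -> 2 * C <= T * quad (design_mx Sigma lam) u.
    by move=> gu; rewrite quadE ler_pM2l//; exact: closure.
  have C2 : 0 < 2 * C by rewrite mulr_gt0.
  have le1 := inv_norm2_le (design_mx_sym Sigma lam) H1 C2 gap0 T0 H2.
  have g2 : 0 < gap ^+ 2 by rewrite exprn_gt0.
  rewrite inver gt_eqF//.
  have gi : (0 <= ((gap ^+ 2)^-1)%:E)%E by rewrite lee_fin invr_ge0 ltW.
  apply: le_trans (lee_wpmul2r gi le1) _; rewrite -EFinM lee_fin.
  by rewrite le_eqVlt; apply/orP; left; apply/eqP; field; rewrite !gt_eqF.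
have C2 : (0 <= (2 * C)%:E)%E by rewrite lee_fin mulr_ge0// ltW.
apply: le_trans (lee_wpmul2l C2 key) _.
rewrite -EFinM [2 * C * _]mulrC divfK ?gt_eqF ?mulr_gt0//.
by rewrite /T fineK.
Qed.
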